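(* Let $\pi$ be the prior on $p\times p$ covariance matrices defined by $\pi(\Sigma)=\pi^u(\Sigma)I(\Sigma\in\mathcal{U}(\tau))/\pi^u(\Sigma\in\mathcal{U}(\tau))$, where $\mathcal{U}(\tau)=\{\Sigma\in\mathcal{C}_p:\tau^{-1}\le\lambda_{\min}(\Sigma)\le\lambda_{\max}(\Sigma)\le\tau\}$ and $\pi^u$ is the prior on symmetric matrices under which, independently, for $1\le j<k\le p$: $\sigma_{kj}=\sigma_{jk}$, $\sigma_{jk}\mid\rho_{jk}\sim N\big(0,\frac{\rho_{jk}}{1-\rho_{jk}}\tau_1^2\big)$, $\rho_{jk}\sim\mathrm{Beta}(a,b)$, and for $j=1,\ldots,p$: $\sigma_{jj}\sim\mathrm{Gamma}(1,\lambda/2)$ (shape $1$, rate $\lambda/2$). For a fixed $\Sigma_0$ and $\epsilon>0$ let $$B_\epsilon=\{f_\Sigma:\Sigma\in\mathcal{C}_p,\ K(f_{\Sigma_0},f_\Sigma)<\epsilon^2,\ V(f_{\Sigma_0},f_\Sigma)<\epsilon^2\},$$ with $K(f_{\Sigma_0},f_\Sigma)=\int f_{\Sigma_0}\log(f_{\Sigma_0}/f_\Sigma)$ and $V(f_{\Sigma_0},f_\Sigma)=\int f_{\Sigma_0}\big(\log(f_{\Sigma_0}/f_\Sigma)\big)^2$, and let $\epsilon_n=\big((p+s_0)\log p/n\big)^{1/2}$. Assume $\Sigma_0\in\mathcal{U}(s_0,\tau_0)=\{\Sigma\in\mathcal{C}_p:|s(\Sigma)|\le s_0,\ \tau_0^{-1}\le\lambda_{\min}(\Sigma)\le\lambda_{\max}(\Sigma)\le\tau_0\}$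 with $\tau_0<\tau$, $p\asymp n^\beta$ for some $0<\beta<1$, $\tau^4\le p$, $\tau^2\tau_0^2\le s_0\log p$, $n\ge\max\{1/\tau_0^4,\ s_0/(1-\tau_0/\tau)^2\}\log p/\tau^4$, $p^{-1}<\lambda<\log p/\tau_0$, $a=b=1/2$ and $\tau_1^2\asymp1/(np^4\tau^2)$. Then, for all sufficiently large $n$, $$\pi(B_{\epsilon_n})\ge\exp\Big\{-\Big(5+\frac1\beta\Big)n\epsilon_n^2\Big\}.$$
   Context: $f_\Sigma$ is the density of $N_p(0,\Sigma)$; $\mathcal{C}_p$ is the set of $p\times p$ positive definite matrices; $|s(\Sigma)|$ is the number of nonzero off-diagonal entries; $s_0$ is a positive integer and $\tau_0>1$. $\pi(B_\epsilon)$ is the prior probability that $f_\Sigma\in B_\epsilon$. The quantities $p,s_0,\tau_1$ (and possibly $\tau,\lambda$) depend on the sample size $n$; $a_n\asymp b_n$ means $a_n/b_n$ is bounded above and away from zero. *)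

(* Defs.v *)
From HB Require Import structures.
From mathcomp Require Import all_boot all_order all_algebra.
From mathcomp Require Import all_classical all_reals all_analysis.
Set Implicit Arguments. Unset Strict Implicit. Unset Printing Implicit Defensive.
Import Order.TTheory GRing.Theory Num.Def Num.Theory.
Import numFieldTopology.Exports.
Local Open Scope classical_set_scope.
Local Open Scope ring_scope.

Section defs.
Context {R : realType}.

Definition posdef (p : nat) (S : 'M[R]_p) : Prop :=
  S^T = S /\ forall x : 'cV[R]_p, x != 0 -> 0 < (x^T *m S *m x) 0 0.

Definition spec_in (p : nat) (S : 'M[R]_p) (lo hi : R) : Prop :=
  forall a : R, eigenvalue S a -> lo <= a <= hi.

Definition U_tau (p : nat) (tau : R) : set 'M[R]_p :=
  [set S | posdef S /\ spec_in S tau^-1 tau].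

Definition offdiag_card (p : nat) (S : 'M[R]_p) : nat :=
  #|[set ij : 'I_p * 'I_p | (ij.1 != ij.2) && (S ij.1 ij.2 != 0)]|.

Definition U_s_tau (p : nat) (s0 : nat) (tau0 : R) : set 'M[R]_p :=
  [set S | posdef S /\ (offdiag_card S <= s0)%N /\ spec_in S tau0^-1 tau0].

Definition gauss_dens (p : nat) (S : 'M[R]_p) (x : 'cV[R]_p) : R :=
  (Num.sqrt ((2 * pi) ^+ p * \det S))^-1 *
  expR (- ((x^T *m invmx S *m x) 0 0) / 2).

(* Lebesgue integral over R^d written as iterated Lebesgue integrals over R *)
Fixpoint iint (d : nat) (F : seq R -> \bar R) : \bar R :=
  match d with
  | 0 => F [::]
  | d'.+1 => (\int[@lebesgue_measure R]_x iint d' (fun s => F (x :: s)))%E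
  end.

Definition vec_of_seq (p : nat) (s : seq R) : 'cV[R]_p := \col_i nth 0 s i.

Definition KLdiv (p : nat) (S0 S : 'M[R]_p) : \bar R :=
  iint p (fun s => let x := vec_of_seq p s in
    (gauss_dens S0 x * ln (gauss_dens S0 x / gauss_dens S x))%:E).

Definition KLvar (p : nat) (S0 S : 'M[R]_p) : \bar R :=
  iint p (fun s => let x := vec_of_seq p s in
    (gauss_dens S0 x * (ln (gauss_dens S0 x / gauss_dens S x)) ^+ 2)%:E).

(* B_eps, as the set of covariance matrices S with f_S in B_eps *)
Definition B_eps (p : nat) (S0 : 'M[R]_p) (eps : R) : set 'M[R]_p :=
  [set S | posdef S /\ (KLdiv S0 S < (eps ^+ 2)%:E)%E
                    /\ (KLvar S0 S < (eps ^+ 2)%:E)%E].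

Definition beta_kernel (a b r : R) : R := r `^ (a - 1) * (1 - r) `^ (b - 1).
Definition beta_function (a b : R) : R :=
  fine (\int[@lebesgue_measure R]_(r in `]0%R, 1%R[) (beta_kernel a b r)%:E)%E.
Definition beta_dens (a b r : R) : R :=
  if (0 < r) && (r < 1) then beta_kernel a b r / beta_function a b else 0.

(* marginal density of sigma_jk (j < k) under pi^u:
   sigma | rho ~ N(0, rho/(1-rho) tau1^2), rho ~ Beta(a, b) *)
Definition offdiag_dens (a b tau1sq x : R) : \bar R :=
  (\int[@lebesgue_measure R]_(r in `]0%R, 1%R[)
     (normal_pdf 0 (Num.sqrt (r / (1 - r) * tau1sq)) x * beta_dens a b r)%:E)%E.

(* density of sigma_jj ~ Gamma(shape 1, rate lam/2) = Exponential(lam/2) *)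
Definition diag_dens (lam x : R) : \bar R := (exponential_pdf (lam / 2) x)%:E.

(* coordinates of a symmetric matrix: upper triangle (j <= k) *)
Definition tri_idx (j k : nat) : nat := ('C(k.+1, 2) + j)%N.
Definition tri_dim (p : nat) : nat := 'C(p.+1, 2).
Definition symmx_of_seq (p : nat) (s : seq R) : 'M[R]_p :=
  \matrix_(i, j) nth 0%R s (tri_idx (minn i j) (maxn i j)).

Definition prior_u_dens (p : nat) (a b tau1sq lam : R) (s : seq R) : \bar R :=
  ((\prod_(k < p) \prod_(j < p | (j < k)%N)
       offdiag_dens a b tau1sq (nth 0%R s (tri_idx j k))) *
   (\prod_(j < p) diag_dens lam (nth 0%R s (tri_idx j j))))%E.

Definition prior_u (p : nat) (a b tau1sq lam : R) (A : set 'M[R]_p) : \bar R :=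
  iint (tri_dim p) (fun s =>
    ((\1_A (symmx_of_seq p s))%:E * prior_u_dens p a b tau1sq lam s)%E).

Definition prior_prob (p : nat) (tau1sq lam tau : R) (A : set 'M[R]_p) : R :=
  fine (prior_u (1/2) (1/2) tau1sq lam (A `&` @U_tau p tau)) /
  fine (prior_u (1/2) (1/2) tau1sq lam (@U_tau p tau)).

End defs.

(* Main.v *)
(* Both divergences are at most a constant times the chi-square divergence, and
   [f0 ^ 2 / f <= C * exp (- (1 - rho) * x^T Q x / 2)] with
   [Q = S0^-1 S S0^-1], where [rho] is of order [||S - S0|| ^ 2]: this holds
   because [2 S0^-1 - S^-1 = Q - S0^-1 D S^-1 D S0^-1] with [D = S - S0], so that
   the first order term in [D] cancels. The Gaussian integral then bounds the
   divergence by [(1 - rho) ^ (- p / 2) - 1].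

   Hence the neighbourhood contains every symmetric matrix whose entries are
   within [1 / (p sqrt n tau)] of those of [Sigma0], and the prior mass of this
   box is a product of one-dimensional integrals. The mixture of normals has
   density at least [c * tau1] on bounded sets, which handles the nonzero entries,
   and mass at most [32 * tau1 / d] outside [[- d, d]], which handles the zeros. *)

Require Import Defs.
From HB Require Import structures.
From mathcomp Require Import all_boot all_order all_algebra.
From mathcomp Require Import all_classical all_reals all_analysis.
From mathcomp Require Import measurable_realfun ring lra.
Import Order.TTheory GRing.Theory Num.Def Num.Theory.
Import numFieldTopology.Exports.
Local Open Scope classical_set_scope.
Local Open Scope ring_scope.

Set Implicit Arguments. Unset Strict Implicit. Unset Printing Implicit Defensive.

(** * Quadratic forms of symmetric matrices *)


Section QuadraticForms.
Context {R : realType}.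
Implicit Types p : nat.

(** Cancelling the first order term decides the size of the box. A bound linear in [||S - S0||]
    would need [||S - S0||] of order [log p / n] to stay below [eps ^ 2]; the box would shrink by a
    factor of order [sqrt n], up to powers of [log p] and [tau], and the tail mass of order
    [tau1 / d] of each zero entry would grow by the same factor. The quadratic bound
    [p * ||S - S0|| ^ 2] admits [||S - S0||] of order [1 / sqrt n], so that [tau1 / d] is of order
    [1 / p] and the at most [p ^ 2] entries together lose only a factor [exp (- c * p)].

    The radius must also keep the spectrum inside the truncation set [U_tau]. The normalising
    constant of the truncated prior is at most [1], so dividing by it can only increase the mass.

    All multiple integrals are iterated one-dimensional ones, compared by monotonicity. Only two
    families of them are evaluated: Gaussian exponentials, by Schur complements, and products of
    functions of single coordinates. *)

Definition bform p (A : 'M[R]_p) (x y : 'cV[R]_p) : R := (x^T *m A *m y) 0 0.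
Definition qform p (A : 'M[R]_p) (x : 'cV[R]_p) : R := (x^T *m A *m x) 0 0.
Definition sqnorm p (x : 'cV[R]_p) : R := \sum_i x i 0 ^+ 2.

Lemma sqnormE p (x : 'cV[R]_p) : sqnorm x = (x^T *m x) 0 0.
Proof. by rewrite mxE; apply: eq_bigr => i _; rewrite mxE expr2. Qed.

Lemma qform1 p (x : 'cV[R]_p) : qform 1%:M x = sqnorm x.
Proof. by rewrite /qform mulmx1 sqnormE. Qed.

Lemma sqnorm_ge0 p (x : 'cV[R]_p) : 0 <= sqnorm x.
Proof. by apply: sumr_ge0 => i _; exact: sqr_ge0. Qed.

Lemma sqnorm_eq0 p (x : 'cV[R]_p) : (sqnorm x == 0) = (x == 0).
Proof.
apply/idP/eqP => [|->]; last first.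
  by rewrite /sqnorm big1// => i _; rewrite mxE expr0n.
rewrite psumr_eq0; last by move=> i _; exact: sqr_ge0.
move=> /allP x0; apply/matrixP => i j; rewrite ord1 mxE; apply/eqP.
by have := x0 i (mem_index_enum i); rewrite sqrf_eq0.
Qed.

Lemma sqnorm_gt0 p (x : 'cV[R]_p) : (0 < sqnorm x) = (x != 0).
Proof. by rewrite lt_neqAle sqnorm_ge0 andbT eq_sym sqnorm_eq0. Qed.

Lemma qformE p (A : 'M[R]_p) (x : 'cV[R]_p) :
  qform A x = \sum_i \sum_j x i 0 * A i j * x j 0.
Proof.
rewrite /qform mxE exchange_big /=; apply: eq_bigr => j _.
by rewrite mxE mulr_suml; apply: eq_bigr => i _; rewrite mxE.
Qed.

Lemma qformB p (A B : 'M[R]_p) x : qform (A - B) x = qform A x - qform B x.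
Proof. by rewrite /qform mulmxBr mulmxBl !mxE. Qed.

Lemma qformN p (A : 'M[R]_p) x : qform (- A) x = - qform A x.
Proof. by rewrite /qform mulmxN mulNmx !mxE. Qed.

Lemma qformZ p (A : 'M[R]_p) a x : qform (a *: A) x = a * qform A x.
Proof. by rewrite /qform -scalemxAr -scalemxAl !mxE. Qed.

Lemma qform_scalar p a (x : 'cV[R]_p) : qform a%:M x = a * sqnorm x.
Proof. by rewrite -scalemx1 qformZ qform1. Qed.

Lemma qform_mul p (A B : 'M[R]_p) x : qform (B^T *m A *m B) x = qform A (B *m x).
Proof. by rewrite /qform trmx_mul !mulmxA. Qed.

Lemma bformC p (A : 'M[R]_p) x y : A^T = A -> bform A x y = bform A y x.
Proof.
move=> sA; rewrite /bform -[RHS](mxE trmx_key (fun i j => (y^T *m A *m x) j i)).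
by rewrite -/(trmx _) !trmx_mul trmxK sA mulmxA.
Qed.

Lemma qform_comb p (A : 'M[R]_p) a b x y : A^T = A ->
  qform A (a *: x + b *: y) =
    a ^+ 2 * qform A x + a * b * bform A x y *+ 2 + b ^+ 2 * qform A y.
Proof.
move=> sA.
have -> : qform A (a *: x + b *: y) = a ^+ 2 * qform A x + a * b * bform A x y
   + a * b * bform A y x + b ^+ 2 * qform A y.
  rewrite /qform /bform.
  have -> : (a *: x + b *: y)^T = a *: x^T + b *: y^T by rewrite linearD !linearZ.
  rewrite !mulmxDl !mulmxDr -!scalemxAr -!scalemxAl.
  by move: (_ *m _) (_ *m _) (_ *m _) (_ *m _) => a1 a2 a3 a4; rewrite !mxE; ring.
rewrite (bformC y x sA); ring.
Qed.

(** If [0 < v], nonnegativity at [v *: x - b *: y] reads [0 <= v * (u * v - b ^+ 2)]; the case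
    [0 < u] is symmetric. Since [A] is only semidefinite both may vanish, and then [x + y] and
    [x - y] force [b = 0]. Semidefiniteness is all that is available for the shifted matrix in
    [rayleigh_ge]. *)
Lemma qform_cauchy_schwarz p (A : 'M[R]_p) x y : A^T = A ->
  (forall z, 0 <= qform A z) -> bform A x y ^+ 2 <= qform A x * qform A y.
Proof.
move=> sA A0; set b := bform A x y; set u := qform A x; set v := qform A y.
have H a c : 0 <= a ^+ 2 * u + a * c * b *+ 2 + c ^+ 2 * v.
  by rewrite -qform_comb.
have u0 : 0 <= u := A0 x.
have v0 : 0 <= v := A0 y.
have [vp|] := ltrP 0 v.
  have := H v (- b).
  have -> : v ^+ 2 * u + v * - b * b *+ 2 + (- b) ^+ 2 * v = v * (u * v - b ^+ 2)
    by ring.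
  by rewrite pmulr_rge0// subr_ge0.
move=> vle; have {v0 vle} v0 : v = 0 by apply/eqP; rewrite eq_le vle v0.
have [up|] := ltrP 0 u.
  have := H (- b) u.
  have -> : (- b) ^+ 2 * u + - b * u * b *+ 2 + u ^+ 2 * v = u * (u * v - b ^+ 2)
    by ring.
  by rewrite pmulr_rge0// subr_ge0.
move=> ule; have {u0 ule} u0 : u = 0 by apply/eqP; rewrite eq_le ule u0.
have := H 1 1; have := H 1 (- 1); rewrite u0 v0 => h1 h2.
by have -> : b = 0 by lra.
Qed.

Lemma bform1_cauchy_schwarz p (x y : 'cV[R]_p) :
  (x^T *m y) 0 0 ^+ 2 <= sqnorm x * sqnorm y.
Proof.
have := @qform_cauchy_schwarz p 1%:M x y (trmx1 _ _).
rewrite /bform mulmx1 !qform1; apply => z; rewrite qform1; exact: sqnorm_ge0.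
Qed.

Lemma sum_norm_sqr_le p (x : 'cV[R]_p) :
  (\sum_i `|x i 0|) ^+ 2 <= p%:R * sqnorm x.
Proof.
have := bform1_cauchy_schwarz (const_mx 1) (\col_i `|x i 0|).
have -> : ((const_mx 1 : 'cV[R]_p)^T *m \col_i `|x i 0|) 0 0 = \sum_i `|x i 0|.
  by rewrite mxE; apply: eq_bigr => i _; rewrite !mxE mul1r.
have -> : sqnorm (\col_i `|x i 0|) = sqnorm x.
  by apply: eq_bigr => i _; rewrite mxE real_normK// num_real.
suff -> : sqnorm (const_mx 1 : 'cV[R]_p) = p%:R by [].
rewrite /sqnorm (eq_bigr (fun=> 1)); last by move=> i _; rewrite mxE expr1n.
by rewrite sumr_const card_ord.
Qed.

Lemma qform_le_entries p (A : 'M[R]_p) (d : R) x :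
  (forall i j, `|A i j| <= d) -> `|qform A x| <= p%:R * d * sqnorm x.
Proof.
(* A negative [d] is possible only when there are no entries, that is for [p = 0]. *)
move=> Ad; have [d0|d0] := ltP d 0.
  case: p A x Ad => [|p] A x Ad; last by have := le_trans (normr_ge0 _) (Ad 0 0); rewrite leNgt d0.
  by rewrite qformE big_ord0 normr0 !mul0r.
rewrite qformE.
have : `|\sum_i \sum_j x i 0 * A i j * x j 0| <= d * (\sum_i `|x i 0|) ^+ 2.
  apply: (le_trans (ler_norm_sum _ _ _)).
  rewrite expr2 mulr_sumr mulr_sumr; apply: ler_sum => i _.
  apply: (le_trans (ler_norm_sum _ _ _)).
  rewrite [_ * `|x i 0|]mulrC mulr_sumr mulr_sumr; apply: ler_sum => j _.
  by rewrite !normrM [`|x i 0| * _]mulrC -mulrA ler_wpM2r// mulr_ge0.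
by move=> /le_trans; apply; rewrite [p%:R * d]mulrC -mulrA ler_wpM2l// sum_norm_sqr_le.
Qed.

Lemma sqnorm_mul_le_entries p (A : 'M[R]_p) (d : R) x :
  (forall i j, `|A i j| <= d) -> sqnorm (A *m x) <= (p%:R * d) ^+ 2 * sqnorm x.
Proof.
move=> Ad.
have H i : (A *m x) i 0 ^+ 2 <= p%:R * d ^+ 2 * sqnorm x.
  have d0 : 0 <= d := le_trans (normr_ge0 _) (Ad i i).
  have : `|(A *m x) i 0| <= d * \sum_j `|x j 0|.
    rewrite mxE mulr_sumr; apply: (le_trans (ler_norm_sum _ _ _)).
    by apply: ler_sum => j _; rewrite normrM ler_wpM2r.
  move=> h; rewrite -[X in X <= _](real_normK (num_real _)).
  have : `|(A *m x) i 0| ^+ 2 <= (d * \sum_j `|x j 0|) ^+ 2.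
    by rewrite ler_pXn2r ?nnegrE// mulr_ge0// sumr_ge0.
  move=> /le_trans; apply; rewrite exprMn.
  by rewrite [p%:R * _]mulrC -[leRHS]mulrA ler_wpM2l ?sqr_ge0// sum_norm_sqr_le.
rewrite {1}/sqnorm; apply: (le_trans (ler_sum _ (fun i _ => H i))).
rewrite sumr_const card_ord -[leLHS]mulr_natl !mulrA exprMn.
by rewrite -[_ * _ * d ^+2]mulrA expr2 !mulrA.
Qed.

Lemma qform_bound p (A : 'M[R]_p) :
  exists2 K : R, 0 < K & forall x, `|qform A x| <= K * sqnorm x.
Proof.
pose d : R := \sum_i \sum_j `|A i j|.
have d0 : 0 <= d by apply: sumr_ge0 => i _; apply: sumr_ge0 => j _.
exists (p%:R * d + 1) => [|x]; first by rewrite ltr_wpDl// mulr_ge0.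
apply: (le_trans (@qform_le_entries p A d x _)); last first.
  by rewrite ler_wpM2r ?sqnorm_ge0// lerDl.
move=> i j; rewrite /d (bigD1 i)//= (bigD1 j)//= -addrA lerDl.
by rewrite addr_ge0//; apply: sumr_ge0 => ? _ //; apply: sumr_ge0.
Qed.

Lemma qform_posdef_unit p (A : 'M[R]_p) :
  (forall x, x != 0 -> 0 < qform A x) -> A \in unitmx.
Proof.
move=> A0; rewrite -row_free_unit -kermx_eq0; apply/rowV0P => v /sub_kermxP vA.
apply/eqP/contraT => v0; have := A0 v^T; rewrite /qform trmxK vA mul0mx mxE ltxx.
by apply; rewrite -trmx0 (inj_eq trmx_inj).
Qed.

(* The supremum [t] of the lower bounds of the Rayleigh quotient is an
   eigenvalue: if [S - t] were invertible, Cauchy-Schwarz for the form [S - t]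
   with [y = (S - t)^-1 x] would bound [S - t] away from [0]. *)
Lemma rayleigh_ge p (S : 'M[R]_p) (lo : R) : S^T = S ->
  (forall a, eigenvalue S a -> lo <= a) ->
  forall x, lo * sqnorm x <= qform S x.
Proof.
move=> sS Slo x; have [->|x0] := eqVneq x 0.
  have /eqP -> : sqnorm (0 : 'cV[R]_p) == 0 by rewrite sqnorm_eq0.
  by rewrite mulr0 /qform mulmx0 mxE.
pose E := [set t : R | forall z, t * sqnorm z <= qform S z].
have [K K0 SK] := qform_bound S.
have EK : E (- K).
  by move=> z; rewrite mulNr; have := SK z; rewrite ler_norml => /andP[].
have ubE z : z != 0 -> ubound E (qform S z / sqnorm z).
  by move=> z0 t /(_ z); rewrite ler_pdivlMr// sqnorm_gt0.
have Et : E (sup E).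
  move=> z; have [->|z0] := eqVneq z 0.
    have /eqP -> : sqnorm (0 : 'cV[R]_p) == 0 by rewrite sqnorm_eq0.
    by rewrite mulr0 /qform mulmx0 mxE.
  rewrite -ler_pdivlMr ?sqnorm_gt0//; apply: ge_sup; [by exists (- K)|exact: ubE].
set t := sup E in Et *.
suff : lo <= t.
  by move=> lot; apply: le_trans (Et x); rewrite ler_wpM2r// sqnorm_ge0.
apply: Slo; apply: contraT; rewrite /eigenvalue/= negbK /eigenspace kermx_eq0.
rewrite row_free_unit => Au; exfalso; set A := S - t%:M in Au.
have sA : A^T = A by rewrite /A linearB/= sS tr_scalar_mx.
have A0 z : 0 <= qform A z by rewrite qformB qform_scalar subr_ge0.
have [L L0 AL] := qform_bound (invmx A).
have lower z : L^-1 * sqnorm z <= qform A z.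
  have [->|z0] := eqVneq z 0.
    have /eqP -> : sqnorm (0 : 'cV[R]_p) == 0 by rewrite sqnorm_eq0.
    by rewrite mulr0 /qform mulmx0 mxE.
  have := qform_cauchy_schwarz z (invmx A *m z) sA A0.
  have -> : bform A z (invmx A *m z) = sqnorm z.
    by rewrite /bform -mulmxA mulKVmx// sqnormE.
  have -> : qform A (invmx A *m z) = qform (invmx A) z.
    by rewrite -qform_mul trmx_inv sA mulVmx// mul1mx.
  move=> h; have := AL z; rewrite ler_norml => /andP[_ h2].
  have : sqnorm z ^+ 2 <= qform A z * (L * sqnorm z).
    by apply: (le_trans h); rewrite ler_wpM2l.
  rewrite expr2 mulrA ler_pM2r ?sqnorm_gt0// => h3.
  by rewrite mulrC ler_pdivrMr.
have : E (t + L^-1).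
  by move=> z; have := lower z; rewrite qformB qform_scalar mulrDl; lra.
move=> /(ub_le_sup (ex_intro _ _ (ubE x x0))); rewrite -/t.
by rewrite gerDl leNgt invr_gt0 L0.
Qed.

Lemma rayleigh_le p (S : 'M[R]_p) (hi : R) : S^T = S ->
  (forall a, eigenvalue S a -> a <= hi) ->
  forall x, qform S x <= hi * sqnorm x.
Proof.
move=> sS Shi x.
have : - hi * sqnorm x <= qform (- S) x.
  apply: rayleigh_ge => [|a]; first by rewrite linearN/= sS.
  move=> /eigenvalueP[v vS v0]; rewrite lerNl; apply: Shi.
  apply/eigenvalueP; exists v => //; move: vS; rewrite mulmxN scaleNr => <-.
  by rewrite opprK.
by rewrite qformN mulNr lerN2.
Qed.

Lemma spec_in_of_qform p (S : 'M[R]_p) (lo hi : R) : S^T = S ->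
  (forall x, lo * sqnorm x <= qform S x <= hi * sqnorm x) -> spec_in S lo hi.
Proof.
move=> sS H a /eigenvalueP[v vS v0].
have : qform S v^T = a * sqnorm v^T.
  by rewrite /qform trmxK vS -scalemxAl mxE sqnormE trmxK.
have vT0 : v^T != 0 by rewrite -trmx0 (inj_eq trmx_inj).
have := H v^T => /[swap] ->; by rewrite !ler_pM2r ?sqnorm_gt0.
Qed.

Lemma qform_delta p (S : 'M[R]_p) i : qform S (delta_mx i 0) = S i i.
Proof. by rewrite /qform trmx_delta -rowE -colE !mxE. Qed.

(** Cauchy-Schwarz at two basis vectors gives [S i j ^+ 2 <= S i i * S j j]. This confines the
    entries of [S0] to a bounded set, on which the prior densities have a lower bound. *)
Lemma entry_le_qform p (S : 'M[R]_p) (hi : R) : S^T = S ->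
  (forall x, 0 <= qform S x <= hi * sqnorm x) ->
  forall i j, `|S i j| <= hi.
Proof.
move=> sS H i j.
have H1 k : 0 <= S k k <= hi.
  have := H (delta_mx k 0); rewrite qform_delta.
  suff -> : sqnorm (delta_mx k 0 : 'cV[R]_p) = 1 by rewrite mulr1.
  by rewrite -qform1 qform_delta mxE eqxx.
have := @qform_cauchy_schwarz p S (delta_mx i 0) (delta_mx j 0) sS.
rewrite !qform_delta {1}/bform trmx_delta -rowE -colE !mxE => h.
have hi0 : 0 <= hi by have /andP[] := H1 i; exact: le_trans.
have {}h : S i j ^+ 2 <= hi ^+ 2.
  apply: (le_trans (h _)) => [z|]; first by case/andP: (H z).
  by case/andP: (H1 i) => ? ?; case/andP: (H1 j) => ? ?; rewrite expr2 ler_pM.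
by rewrite -(ger0_norm hi0) -ler_sqr ?nnegrE// !real_normK ?num_real.
Qed.

Lemma trmx_invmx_sym p (S : 'M[R]_p) : S^T = S -> (invmx S)^T = invmx S.
Proof. by move=> sS; rewrite trmx_inv sS. Qed.

(** With [y = S *m x], both [qform (invmx S) y] and the scalar product of [x] and [y] equal
    [qform S x]; Cauchy-Schwarz and [lo * sqnorm x <= qform S x] then give the bound without
    diagonalising [S]. *)
Lemma qform_invmx_le p (S : 'M[R]_p) (lo : R) : 0 < lo -> S \in unitmx ->
  (forall x, lo * sqnorm x <= qform S x) ->
  S^T = S -> forall y, qform (invmx S) y <= sqnorm y / lo.
Proof.
move=> lo0 uS H sS y; set x := invmx S *m y.
have yE : y = S *m x by rewrite mulKVmx.
have qE : qform (invmx S) y = qform S x.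
  by rewrite /x -qform_mul trmx_invmx_sym// mulVmx// mul1mx.
have bE : (x^T *m y) 0 0 = qform S x by rewrite yE /qform mulmxA.
have := bform1_cauchy_schwarz x y; rewrite bE => h.
have q0 : 0 <= qform S x by apply: le_trans (H x); rewrite mulr_ge0 ?sqnorm_ge0 ?ltW.
rewrite qE; have [qp|] := ltrP 0 (qform S x); last first.
  by move=> /le_trans; apply; rewrite divr_ge0 ?sqnorm_ge0 ?ltW.
rewrite ler_pdivlMr// -(ler_pM2l qp) mulrA -expr2.
apply: (@le_trans _ _ (sqnorm x * sqnorm y * lo)); first by rewrite ler_pM2r.
by rewrite mulrAC [sqnorm x * lo]mulrC ler_wpM2r ?sqnorm_ge0.
Qed.

(* With [P0 = S0^-1], [P = S^-1] and [D = S - S0], one has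
   [2 P0 - P = P0 S P0 - P0 D P D P0]. *)
Lemma qform_precision_ge p (S0 S : 'M[R]_p) (lo d : R) : 0 < lo ->
  S0^T = S0 -> S^T = S -> S0 \in unitmx -> S \in unitmx ->
  (forall x, lo * sqnorm x <= qform S x) ->
  (forall i j, `|S i j - S0 i j| <= d) ->
  forall x,
  (1 - (p%:R * d / lo) ^+ 2) * qform (invmx S0 *m S *m invmx S0) x <=
    qform (2%:R *: invmx S0 - invmx S) x.
Proof.
move=> lo0 sS0 sS uS0 uS H Hd x.
set P0 := invmx S0; set P := invmx S; set D := S - S0.
have sP0 : P0^T = P0 by exact: trmx_invmx_sym.
have sD : D^T = D by rewrite /D linearB/= sS sS0.
have key : 2%:R *: P0 - P = P0 *m S *m P0 - P0 *m (D *m P *m D) *m P0.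
  have -> : D *m P *m D = S - S0 - S0 + S0 *m P *m S0.
    rewrite /D mulmxBr !mulmxBl mulmxV// mul1mx -mulmxA mulVmx// mulmx1.
    by rewrite mul1mx opprB addrA addrAC.
  have SS : P0 *m S0 = 1%:M by rewrite mulVmx.
  have SS' : S0 *m P0 = 1%:M by rewrite mulmxV.
  rewrite mulmxDr !mulmxBr mulmxDl !mulmxBl.
  rewrite !mulmxA SS !mul1mx -[P *m S0 *m P0]mulmxA SS' mulmx1.
  by rewrite scaler_nat mulr2n !opprD !opprK !addrA subrr add0r.
set y := P0 *m x.
have E1 : qform (P0 *m S *m P0) x = qform S y by rewrite -{1}sP0 qform_mul.
have E2 : qform (P0 *m (D *m P *m D) *m P0) x = qform P (D *m y).
  by rewrite -{1}sP0 qform_mul -{1}sD qform_mul.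
(* The remainder is compared with [qform S y] rather than [sqnorm y], so that the lower bound is a
   multiple of [P0 *m S *m P0], whose determinant is explicit. *)
rewrite key qformB E1 E2 mulrBl mul1r lerB//.
apply: (le_trans (qform_invmx_le lo0 uS H sS _)).
rewrite ler_pdivrMr//.
apply: (@le_trans _ _ ((p%:R * d) ^+ 2 * sqnorm y)).
  by apply: sqnorm_mul_le_entries => i j; rewrite !mxE.
rewrite [X in _ <= X](_ : _ = (p%:R * d) ^+ 2 * (qform S y / lo)).
  by rewrite ler_wpM2l ?sqr_ge0// ler_pdivlMr// mulrC.
by field; rewrite gt_eqF.
Qed.

End QuadraticForms.

(** * Iterated integrals and Gaussian integrals *)


Section IteratedIntegral.
Context {R : realType}.
Local Notation mu := (@lebesgue_measure R).

Import HBNNSimple.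

(* No measurability is needed: the integral of a nonnegative function is a
   supremum over the simple functions below it. *)
Lemma le_integral_pointwise d (T : measurableType d)
  (m : {measure set T -> \bar R}) (D : set T) (f g : T -> \bar R) :
  (forall x, D x -> f x <= g x)%E ->
  (\int[m]_(x in D) f x <= \int[m]_(x in D) g x)%E.
Proof.
move=> fg; rewrite /integral.
have pos_le : forall h k : T -> \bar R, (forall x, h x <= k x)%E ->
  forall x, (h^\+ x <= k^\+ x)%E /\ (k^\- x <= h^\- x)%E.
  move=> h k hk x; rewrite !funeposE !funenegE; split.
    by rewrite ge_max !le_max hk lexx orbT.
  by rewrite ge_max !le_max leeN2 hk lexx orbT.
have {}fg x : ((f \_ D) x <= (g \_ D) x)%E.
  by rewrite !patchE; case: ifPn => // /set_mem; exact: fg.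
apply: leeB; apply: le_ereal_sup => _ /= [h hle <-]; exists h => // x.
  exact: le_trans (hle x) (pos_le _ _ fg x).1.
exact: le_trans (hle x) (pos_le _ _ fg x).2.
Qed.

Lemma le_iint d (F G : seq R -> \bar R) :
  (forall s, size s = d -> F s <= G s)%E -> (iint d F <= iint d G)%E.
Proof.
elim: d F G => [|d IH] F G FG /=; first exact: FG.
apply: le_integral_pointwise => x _; apply: IH => s sd; apply: FG.
by rewrite /= sd.
Qed.

Lemma eq_iint d (F G : seq R -> \bar R) :
  (forall s, size s = d -> F s = G s) -> iint d F = iint d G.
Proof.
by move=> FG; apply/eqP; rewrite eq_le !le_iint// => s /FG ->.
Qed.

(** Integrability at every stage of the iteration and for every value of the outer variables, which
    is what linearity of [iint] on signed integrands requires. *)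
Fixpoint iintegrable (d : nat) (F : seq R -> R) : Prop :=
  match d with
  | 0 => True
  | d'.+1 => (forall x, iintegrable d' (fun s => F (x :: s))) /\
      mu.-integrable setT (fun x => iint d' (fun s => (F (x :: s))%:E))
  end.

Lemma iintD d F G : iintegrable d F -> iintegrable d G ->
  iintegrable d (fun s => F s + G s) /\
  (iint d (fun s => (F s + G s)%:E) =
   iint d (fun s => (F s)%:E) + iint d (fun s => (G s)%:E))%E.
Proof.
elim: d F G => [//|d IH] F G /= [F1 F2] [G1 G2].
have E x : (iint d (fun s => (F (x :: s) + G (x :: s))%:E) =
   iint d (fun s => (F (x :: s))%:E) + iint d (fun s => (G (x :: s))%:E))%E.
  by have [] := IH _ _ (F1 x) (G1 x).
split; last by under eq_integral do rewrite E; rewrite integralD.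
split=> [x|]; first by have [] := IH _ _ (F1 x) (G1 x).
by apply: eq_integrable (integrableD measurableT F2 G2) => // x _; rewrite /= E.
Qed.

Lemma iintZ d (c : R) F : iintegrable d F ->
  iintegrable d (fun s => c * F s) /\
  (iint d (fun s => (c * F s)%:E) = c%:E * iint d (fun s => (F s)%:E))%E.
Proof.
elim: d F => [//|d IH] F /= [F1 F2].
have E x : (iint d (fun s => (c * F (x :: s))%:E) =
   c%:E * iint d (fun s => (F (x :: s))%:E))%E.
  by have [] := IH _ (F1 x).
split; last by under eq_integral do rewrite E; rewrite integralZl.
split=> [x|]; first by have [] := IH _ (F1 x).
by apply: eq_integrable (integrableZl measurableT c F2) => // x _; rewrite /= E.
Qed.

Lemma eq_iintegrable d F G : (forall s, size s = d -> F s = G s) ->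
  iintegrable d F -> iintegrable d G.
Proof.
elim: d F G => [//|d IH] F G FG /= [F1 F2]; split=> [x|].
  by apply: IH (F1 x) => s sd; apply: FG; rewrite /= sd.
apply: eq_integrable F2 => // x _; apply: eq_iint => s sd.
by rewrite FG//= sd.
Qed.

(** The constant [c] is there for the induction: with the outer variable [x] fixed, the factor
    [h 0 x] is absorbed into it. It is extended real because the factors are. *)
Lemma iint_prod (d : nat) (c : \bar R) (h : nat -> R -> \bar R) : (0 <= c)%E ->
  (forall i, measurable_fun [set: R] (h i)) -> (forall i x, 0 <= h i x)%E ->
  (iint d (fun s => c * \prod_(i < d) h i (nth 0%R s i)) =
   c * \prod_(i < d) \int[mu]_x h i x)%E.
Proof.
move=> c0 mh h0; elim: d c c0 h mh h0 => [|d IH] c c0 h mh h0 /=.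
  by rewrite !big_ord0.
rewrite big_ord_recl/=.
transitivity (\int[mu]_x ((c * \prod_(i < d) \int[mu]_y h i.+1 y) * h 0%N x))%E.
  apply: eq_integral => x _.
  rewrite (eq_iint (G := fun s => ((c * h 0%N x) * \prod_(i < d) h i.+1 (nth 0%R s i))%E)).
    rewrite (IH _ _ (fun i => h i.+1))//; first by rewrite muleAC.
    exact: mule_ge0.
  by move=> s _; rewrite big_ord_recl/= muleA.
rewrite ge0_integralZl//; [by rewrite muleAC muleA|exact: mh|].
by rewrite mule_ge0// prode_ge0// => i _; exact: integral_ge0.
Qed.

Lemma integral_gauss1 (s m : R) : 0 < s ->
  mu.-integrable setT (fun x => (expR (- (s * (x - m) ^+ 2) / 2))%:E) /\
  (\int[mu]_x (expR (- (s * (x - m) ^+ 2) / 2))%:E = (Num.sqrt (2 * pi / s))%:E)%E.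
Proof.
move=> s0; pose sg := (Num.sqrt s)^-1.
have sg0 : sg != 0 by rewrite invr_neq0// gt_eqF// sqrtr_gt0.
have sg2 : sg ^+ 2 = s^-1 by rewrite exprVn sqr_sqrtr// ltW.
have E x : expR (- (s * (x - m) ^+ 2) / 2) =
    Num.sqrt (2 * pi / s) * normal_pdf m sg x.
  rewrite normal_pdfE// /normal_peak /normal_fun [RHS]mulrA sg2.
  rewrite [X in Num.sqrt X * _](_ : _ = s^-1 * pi *+ 2); last first.
    by rewrite -mulr_natr; ring.
  rewrite divff ?mul1r; last first.
    by rewrite gt_eqF// sqrtr_gt0 pmulrn_lgt0// mulr_gt0// ?invr_gt0 ?pi_gt0.
  congr expR; rewrite -mulr_natr; field; rewrite gt_eqF//.
split.
  apply: eq_integrable (integrableZl measurableT (Num.sqrt (2 * pi / s))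
    (integrable_normal_pdf m sg)) => // x _.
  by rewrite E EFinM.
under eq_integral do rewrite E EFinM.
by rewrite integralZl//= ?integral_normal_pdf ?mule1//; exact: integrable_normal_pdf.
Qed.

Lemma vec_of_seq_cons d x (s : seq R) :
  vec_of_seq d.+1 (x :: s) = (col_mx (x%:M : 'M[R]_1) (vec_of_seq d s) : 'cV[R]_(1 + d)).
Proof.
apply/colP => i; rewrite !mxE; case: splitP => j ij; rewrite !mxE.
  by rewrite ij ord1 eqxx mulr1n.
by rewrite ij.
Qed.

(* Schur complement: completing the square in the last [d] coordinates. *)
Lemma qform_schur d (P : 'M[R]_(1 + d)) (u : 'M[R]_1) (v : 'cV[R]_d) :
  P^T = P -> drsubmx P \in unitmx ->
  qform P (col_mx u v) =
  (ulsubmx P - ursubmx P *m invmx (drsubmx P) *m dlsubmx P) 0 0 * (u 0 0) ^+ 2 +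
  qform (drsubmx P) (v + invmx (drsubmx P) *m dlsubmx P *m u).
Proof.
move=> sP uP.
have urE : ursubmx P = (dlsubmx P)^T by rewrite -[in RHS]sP -trmx_ursub trmxK.
have sQ : (drsubmx P)^T = drsubmx P by rewrite trmx_drsub sP.
set Q := drsubmx P in uP sQ *; set b := dlsubmx P in urE *; set a := ulsubmx P.
rewrite urE; set T := a - _.
have -> : T 0 0 * u 0 0 ^+ 2 = (u^T *m T *m u) 0 0.
  by rewrite !mxE !big_ord1 !mxE big_ord1 !mxE; ring.
have sQi := trmx_invmx_sym sQ.
have E : (v + invmx Q *m b *m u)^T = v^T + u^T *m b^T *m invmx Q.
  by rewrite linearD/= !trmx_mul sQi mulmxA.
rewrite /qform E -{1}[P]submxK -/Q -/b -/a urE.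
rewrite tr_col_mx mul_row_block mul_row_col !mulmxDl !mulmxDr !mulmxDl.
rewrite mulmxN mulNmx -!mulmxA [Q *m (invmx Q *m _)]mulmxA mulmxV// mul1mx.
rewrite [invmx Q *m (Q *m _)]mulmxA mulVmx// mul1mx.
move: (_ *m _) (_ *m _) (_ *m _) (_ *m _) (_ *m _) => t1 t2 t3 t4 t5.
by rewrite ![fun_of_matrix (_ + _) _ _]mxE ![fun_of_matrix (- _) _ _]mxE; ring.
Qed.

Lemma det_schur d (P : 'M[R]_(1 + d)) : drsubmx P \in unitmx ->
  \det P = (ulsubmx P - ursubmx P *m invmx (drsubmx P) *m dlsubmx P) 0 0
            * \det (drsubmx P).
Proof.
move=> uP; set Q := drsubmx P; set T := ulsubmx P - _.
have -> : P = block_mx 1%:M (ursubmx P *m invmx Q) 0 1%:M *m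
              block_mx T 0 (dlsubmx P) Q.
  rewrite mulmx_block !mul1mx !mul0mx !add0r -[in RHS]mulmxA.
  by rewrite mulmxA -[_ *m Q]mulmxA mulVmx// mulmx1 /T subrK -[LHS]submxK.
by rewrite det_mulmx det_ublock det_lblock !det1 !mul1r det_mx11.
Qed.

(** The mean [m] is generalised because completing the square shifts the mean of the inner variables
    by an amount depending on the outer one; the value of the inner integral does not depend on that
    mean and factors out. Positivity of the determinant comes from the same induction, as a product
    of Schur complements. *)
Lemma gauss_iint d (P : 'M[R]_d) (m : 'cV[R]_d) : P^T = P ->
  (forall x, x != 0 -> 0 < qform P x) ->
  [/\ 0 < \det P,
    iintegrable d (fun s => expR (- qform P (vec_of_seq d s - m) / 2)) &
    iint d (fun s => (expR (- qform P (vec_of_seq d s - m) / 2))%:E) =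
      (Num.sqrt ((2 * pi) ^+ d / \det P))%:E].
Proof.
elim: d P m => [|d IH] P m sP pP.
  rewrite det_mx00; split => //=.
  by rewrite qformE big_ord0 oppr0 mul0r expR0 expr0 divr1 sqrtr1.
rewrite -[d.+1]/(1 + d)%N in P m sP pP *.
set Q := drsubmx P; set b := dlsubmx P.
have sQ : Q^T = Q by rewrite trmx_drsub sP.
have pQ v : v != 0 -> 0 < qform Q v.
  move=> v0; have -> : qform Q v = qform P (col_mx 0 v).
    rewrite /qform -{1}[P]submxK tr_col_mx mul_row_block mul_row_col.
    by rewrite mulmx0 add0r trmx0 mul0mx add0r.
  by apply: pP; rewrite col_mx_eq0 negb_and v0 orbT.
have uQ : Q \in unitmx := qform_posdef_unit pQ.
have schur := qform_schur _ _ sP uQ.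
have detE := det_schur uQ; rewrite -/Q -/b in schur detE.
set T := (ulsubmx P - ursubmx P *m invmx Q *m b) 0 0 in schur detE.
have T0 : 0 < T.
  (* This vector annihilates the second square in [schur], so that the form of [P] takes the value
     [T] there. *)
  have n0 : col_mx 1%:M (- (invmx Q *m b *m 1%:M)) != 0 :> 'cV[R]_(1 + d).
    rewrite col_mx_eq0 negb_and; apply/orP; left; apply/eqP => /matrixP/(_ 0 0).
    by rewrite !mxE/= => /eqP; rewrite oner_eq0.
  have := pP _ n0.
  rewrite schur addNr mxE/= mulr1n expr1n mulr1 -trmx0 /qform.
  by rewrite trmx0 mulmx0 mxE addr0.
pose u := usubmx m; pose v := dsubmx m.
pose mean x := v - invmx Q *m b *m (x%:M - u).
have E x (s : seq R) : expR (- qform P (vec_of_seq d.+1 (x :: s) - m) / 2) =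
    expR (- (T * (x - u 0 0) ^+ 2) / 2) *
    expR (- qform Q (vec_of_seq d s - mean x) / 2).
  have -> : vec_of_seq d.+1 (x :: s) - m =
      (col_mx (x%:M - u) (vec_of_seq d s - v) : 'cV[R]_(1 + d)).
    rewrite vec_of_seq_cons.
    transitivity (col_mx x%:M (vec_of_seq d s) - col_mx u v : 'cV[R]_(1 + d)).
      by rewrite vsubmxK.
    by rewrite opp_col_mx add_col_mx.
  have -> : vec_of_seq d s - mean x =
      vec_of_seq d s - v + invmx Q *m b *m (x%:M - u) by rewrite opprB addrA addrAC.
  have -> : x - u 0 0 = (x%:M - u) 0 0 by rewrite !mxE eqxx mulr1n.
  by rewrite schur -expRD -mulrDl -opprD.
have [dQ _ _] := IH Q v sQ pQ.
have [gi gI] := integral_gauss1 (u 0 0) T0.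
have inner x : iintegrable d (fun s => expR (- qform P (vec_of_seq d.+1 (x :: s) - m) / 2)) /\
   iint d (fun s => (expR (- qform P (vec_of_seq d.+1 (x :: s) - m) / 2))%:E) =
   ((Num.sqrt ((2 * pi) ^+ d / \det Q))%:E * (expR (- (T * (x - u 0 0) ^+ 2) / 2))%:E)%E.
  have [_ Qi QI] := IH Q (mean x) sQ pQ.
  have [Zi ZI] := iintZ (expR (- (T * (x - u 0 0) ^+ 2) / 2)) Qi.
  split; first by apply: eq_iintegrable Zi => s _; rewrite E.
  by rewrite muleC -QI -ZI; apply: eq_iint => s _; rewrite E.
split.
- by rewrite detE mulr_gt0.
- split=> [x|]; first by have [] := inner x.
  apply: eq_integrable (integrableZl measurableT (Num.sqrt ((2 * pi) ^+ d / \det Q)) gi) => // x _.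
  by have [_ ->] := inner x.
- rewrite /=; under eq_integral => x _ do rewrite (inner x).2.
  rewrite integralZl// gI -EFinM -sqrtrM; last first.
    by rewrite divr_ge0 ?exprn_ge0 ?mulr_ge0 ?pi_ge0 ?ltW.
  congr (Num.sqrt _)%:E; rewrite detE exprSr; field.
  by rewrite !gt_eqF.
Qed.

End IteratedIntegral.

(** * Divergences between centred Gaussians *)


Section GaussianDivergence.
Context {R : realType}.

(** With [z = ln r] the right side is [4 * (exp (z / 2) - exp (- z / 2)) ^ 2], and
    [w <= exp w - exp (- w)] for [0 <= w]. The expression [r + r^-1 - 2] is chosen because at
    [r = f0 / f], weighted by [f0], it becomes [f0 ^ 2 / f - 2 f0 + f], whose integral is the
    chi-square divergence. *)
Lemma ln_sqr_le (r : R) : 0 < r -> ln r ^+ 2 <= 4 * (r + r^-1 - 2).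
Proof.
move=> r0; set z := ln r.
have E : r + r^-1 - 2 = (expR (z / 2) - expR (- (z / 2))) ^+ 2.
  have -> : r = expR (z / 2) ^+ 2.
    by rewrite -expRM_natr divfK// lnK.
  by rewrite expRN; field; rewrite gt_eqF// expR_gt0.
rewrite E; have -> : z ^+ 2 = 4 * (z / 2) ^+ 2 by field.
rewrite ler_pM2l//; set w := z / 2.
wlog w0 : w / 0 <= w => [H|].
  have [|w0] := leP 0 w; first exact: H.
  have := H (- w); rewrite opprK sqrrN -[X in _ -> _ <= X]sqrrN opprB.
  by apply; rewrite oppr_ge0 ltW.
rewrite ler_pXn2r ?nnegrE//.
  have := expR_ge1Dx w; have : expR (- w) <= 1 by rewrite expR_le1 oppr_le0.
  by lra.
by rewrite subr_ge0 ler_expR; lra.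
Qed.

Lemma posdefP p (S : 'M[R]_p) : posdef S ->
  [/\ S^T = S, S \in unitmx, (invmx S)^T = invmx S &
    forall x, x != 0 -> 0 < qform (invmx S) x].
Proof.
move=> [sS pS]; have uS : S \in unitmx := qform_posdef_unit pS.
have sSi := trmx_invmx_sym sS; split => // x x0.
have -> : invmx S = (invmx S)^T *m S *m invmx S by rewrite sSi mulVmx// mul1mx.
rewrite qform_mul; apply: pS; apply/eqP => /(congr1 (mulmx S)).
by rewrite mulKVmx// mulmx0; apply/eqP.
Qed.

Lemma posdef_det_gt0 p (S : 'M[R]_p) : posdef S -> 0 < \det S.
Proof. by move=> [sS pS]; have [] := gauss_iint 0 sS pS. Qed.

Lemma gauss_densE p (S : 'M[R]_p) x : gauss_dens S x =
  (Num.sqrt ((2 * pi) ^+ p * \det S))^-1 * expR (- qform (invmx S) (x - 0) / 2).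
Proof. by rewrite subr0. Qed.

Lemma two_pi_gt0 : 0 < 2 * pi :> R.
Proof. by rewrite mulr_gt0// pi_gt0. Qed.

Lemma gauss_dens_gt0 p (S : 'M[R]_p) x : posdef S -> 0 < gauss_dens S x.
Proof.
move=> pS; rewrite mulr_gt0 ?expR_gt0// invr_gt0 sqrtr_gt0 mulr_gt0//.
  by rewrite exprn_gt0// two_pi_gt0.
exact: posdef_det_gt0.
Qed.

Lemma iint_gauss_dens p (S : 'M[R]_p) : posdef S ->
  iintegrable p (fun s => gauss_dens S (vec_of_seq p s)) /\
  iint p (fun s => (gauss_dens S (vec_of_seq p s))%:E) = 1%E.
Proof.
move=> pS; have [_ uS sSi pSi] := posdefP pS.
have dS := posdef_det_gt0 pS.
have [_ gi gI] := gauss_iint 0 sSi pSi.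
have [Zi ZI] := iintZ (Num.sqrt ((2 * pi) ^+ p * \det S))^-1 gi.
split; first by apply: eq_iintegrable Zi => s _; rewrite gauss_densE.
transitivity ((Num.sqrt ((2 * pi) ^+ p * \det S))^-1%:E *
    (Num.sqrt ((2 * pi) ^+ p / \det (invmx S)))%:E)%E; last first.
  by rewrite det_inv invrK -EFinM mulVf// gt_eqF// sqrtr_gt0 mulr_gt0// exprn_gt0// two_pi_gt0.
by rewrite -gI -ZI; apply: eq_iint => s _; rewrite gauss_densE.
Qed.

(* Both divergences are controlled by the chi-square divergence
   [\int f0 ^ 2 / f - 1], whose integrand is again Gaussian. *)
Lemma KLdiv_KLvar_le p (S0 S : 'M[R]_p) (lo d : R) (rho := (p%:R * d / lo) ^+ 2) :
  posdef S0 -> posdef S -> 0 < lo -> (forall x, lo * sqnorm x <= qform S x) ->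
  (forall i j, `|S i j - S0 i j| <= d) -> rho < 1 ->
  (KLdiv S0 S <= ((Num.sqrt ((1 - rho) ^+ p))^-1 - 1)%:E)%E /\
  (KLvar S0 S <= (4 * ((Num.sqrt ((1 - rho) ^+ p))^-1 - 1))%:E)%E.
Proof.
move=> pS0 pS lo0 loS dS rho1.
have [sS0 uS0 sP0 pP0] := posdefP pS0; have [sS uS sP pP] := posdefP pS.
have D0 := posdef_det_gt0 pS0; have D := posdef_det_gt0 pS.
pose w := (2 * pi : R) ^+ p; have w0 : 0 < w by rewrite exprn_gt0// two_pi_gt0.
pose Q := (1 - rho) *: (invmx S0 *m S *m invmx S0).
have r0 : 0 < 1 - rho by rewrite subr_gt0.
have sQ : Q^T = Q by rewrite linearZ/= !trmx_mul sP0 sS mulmxA.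
have pQ x : x != 0 -> 0 < qform Q x.
  move=> x0; rewrite qformZ mulr_gt0// -{1}sP0 qform_mul; apply: pS.2.
  apply/eqP => /(congr1 (mulmx S0)); rewrite mulKVmx// mulmx0.
  exact/eqP.
pose f0 s := gauss_dens S0 (vec_of_seq p s).
pose f s := gauss_dens S (vec_of_seq p s).
pose C := Num.sqrt (w * \det S) / (w * \det S0).
pose g s := C * expR (- qform Q (vec_of_seq p s - 0) / 2).
have f0_gt0 s : 0 < f0 s by exact: gauss_dens_gt0.
have f_gt0 s : 0 < f s by exact: gauss_dens_gt0.
have f0fg s : f0 s * (f0 s / f s) <= g s.
  rewrite /f0 /f /gauss_dens -!/(qform _ _) -/w; set x := vec_of_seq p s.
  rewrite /g -/x subr0; set a := qform (invmx S0) x; set b := qform (invmx S) x.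
  have -> : (Num.sqrt (w * \det S0))^-1 * expR (- a / 2) *
      ((Num.sqrt (w * \det S0))^-1 * expR (- a / 2) /
       ((Num.sqrt (w * \det S))^-1 * expR (- b / 2))) =
      C * expR (- (2 * a - b) / 2).
    have -> : - (2 * a - b) / 2 = - a / 2 + - a / 2 - (- b / 2) by field.
    rewrite expRB expRD /C -{3}[w * \det S0]sqr_sqrtr ?mulr_ge0 ?ltW//.
    by field; rewrite !gt_eqF ?expR_gt0// sqrtr_gt0 mulr_gt0.
  rewrite ler_pM2l; last by rewrite divr_gt0 ?sqrtr_gt0 ?mulr_gt0.
  rewrite ler_expR ler_pM2r ?invr_gt0// lerN2 qformZ.
  have := qform_precision_ge lo0 sS0 sS uS0 uS loS dS x.
  by rewrite qformB qformZ.
have [gi gI] : iintegrable p g /\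
    iint p (fun s => (g s)%:E) = ((Num.sqrt ((1 - rho) ^+ p))^-1)%:E.
  have [dQ ei eI] := gauss_iint 0 sQ pQ.
  have [Zi ZI] := iintZ C ei; split => //; rewrite ZI eI -EFinM; congr EFin.
  (* The determinants of [S] and [S0] cancel against [C], and only the power of [1 - rho]
     survives. *)
  have detQ : \det Q = (1 - rho) ^+ p * (\det S / \det S0 ^+ 2).
    rewrite detZ !det_mulmx !det_inv; congr (_ * _).
    by field; rewrite gt_eqF.
  rewrite -/w detQ /C; set k := (1 - rho) ^+ p; have k0 : 0 < k by rewrite exprn_gt0.
  have k1 : Num.sqrt k != 0 by rewrite gt_eqF// sqrtr_gt0.
  rewrite mulrAC -sqrtrM; last by rewrite mulr_ge0 ?ltW.
  have -> : w * \det S * (w / (k * (\det S / \det S0 ^+ 2))) = (w * \det S0) ^+ 2 / k.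
    by field; rewrite !gt_eqF.
  rewrite sqrtrM ?sqr_ge0// sqrtr_sqr gtr0_norm ?mulr_gt0// sqrtrV ?ltW//.
  by field; rewrite k1 !gt_eqF.
have [f0i f0I] := iint_gauss_dens pS0; have [fi fI] := iint_gauss_dens pS.
have [Ni NI] := iintZ (-1) f0i.
have [gf0i gf0I] := iintD gi Ni.
split.
  (* This uses [ln r <= r - 1] at [r = f0 / f]; as [f0] integrates to [1], it contributes the [- 1]
     of the bound. *)
  apply: (@le_trans _ _ (iint p (fun s => (g s + (-1) * f0 s)%:E))); last first.
    by rewrite gf0I gI NI f0I mule1.
  apply: le_iint => s _; rewrite lee_fin -/(f0 s) -/(f s) mulN1r.
  apply: le_trans (lerB (f0fg s) (lexx (f0 s))).
  rewrite -[X in _ - X]mulr1 -mulrBr ler_pM2l//.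
  have r1 : -1 < f0 s / f s - 1 by rewrite ltrBrDr addrC subrr divr_gt0.
  by have := le_ln1Dx r1; rewrite addrC subrK.
(* The added [f - f0] integrates to [0]; it completes [f0 ^ 2 / f - f0] to the integrand provided by
   [ln_sqr_le]. *)
have [gf0fi gf0fI] := iintD gf0i (iintD fi Ni).1.
have [Vi VI] := iintZ 4 gf0fi.
apply: (@le_trans _ _ (iint p (fun s => (4 * (g s + (-1) * f0 s + (f s + (-1) * f0 s)))%:E))); last first.
  by rewrite VI gf0fI gf0I (iintD fi Ni).2 gI NI f0I fI mule1 -!EFinD -EFinM lee_fin; lra.
apply: le_iint => s _; rewrite lee_fin -/(f0 s) -/(f s) !mulN1r.
apply: (@le_trans _ _ (f0 s * (4 * (f0 s / f s + (f0 s / f s)^-1 - 2)))).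
  by rewrite ler_pM2l// ln_sqr_le// divr_gt0.
have -> : f0 s * (4 * (f0 s / f s + (f0 s / f s)^-1 - 2)) =
    4 * (f0 s * (f0 s / f s) - f0 s + (f s - f0 s)).
  by field; rewrite !gt_eqF.
by rewrite ler_pM2l// lerD2r lerD2r.
Qed.

End GaussianDivergence.

(** * The Beta(1/2, 1/2) kernel *)


Section BetaIntegrals.
Context {R : realType}.
Local Notation mu := (@lebesgue_measure R).
Implicit Types (f F : R -> R) (r t : R).

(* [f] may be unbounded at both ends: only increments of the primitive matter. *)
Lemma integral01_le f F (M : R) :
  (forall r, 0 < r < 1 -> 0 <= f r) ->
  (forall r, 0 < r < 1 -> {for r, continuous f}) ->
  (forall r, 0 < r < 1 -> is_derive r 1 F (f r)) ->
  (forall r r', 0 < r < 1 -> 0 < r' < 1 -> F r' - F r <= M) ->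
  (\int[mu]_(r in `]0%R, 1%R[) (f r)%:E <= M%:E)%E.
Proof.
(* The exhausting intervals below start from [e 0 = 1 / 3], which keeps all of them
   nondegenerate. *)
move=> f0 fc dF FM.
pose e n : R := n.+3%:R^-1; pose E n := `[e n, 1 - e n]%classic.
have e0 n : 0 < e n by rewrite invr_gt0 ltr0n.
have e3 n : e n <= 3^-1 by rewrite lef_pV2 ?posrE ?ltr0n// ler_nat.
have E01 n r : e n <= r <= 1 - e n -> 0 < r < 1.
  by move=> /andP[h1 h2]; have := e0 n; lra.
have -> : `]0%R, 1%R[%classic = \bigcup_n E n.
  apply/seteqP; split => r /=; rewrite in_itv/=; last first.
    by move=> [n _]; rewrite /E /= in_itv/=; exact: E01.
  move=> /andP[r0 r1].
  have r1' : 0 < 1 - r by lra.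
  exists (truncn (r^-1 + (1 - r)^-1)) => //.
  rewrite /E /= in_itv/=; set n := truncn _.
  have nE : r^-1 + (1 - r)^-1 <= n.+3%:R.
    by apply: (le_trans (ltW (truncnS_gt _))); rewrite ler_nat; exact: leqW.
  have i1 : 0 < r^-1 by rewrite invr_gt0.
  have i2 : 0 < (1 - r)^-1 by rewrite invr_gt0.
  have h1 : e n <= r.
    by rewrite /e -[leRHS]invrK lef_pV2 ?posrE ?ltr0n//; lra.
  have h2 : e n <= 1 - r.
    by rewrite /e -[leRHS]invrK lef_pV2 ?posrE ?ltr0n//; lra.
  by apply/andP; split => //; lra.
have FTC n : (\int[mu]_(r in E n) (f r)%:E = (F (1 - e n) - F (e n))%:E)%E.
  have dF' r : e n <= r <= 1 - e n -> derivable F r 1.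
    by move=> /E01 /dF ?; exact: ex_derive.
  have cF r : e n <= r <= 1 - e n -> {for r, continuous F}.
    by move=> /dF' h; apply/differentiable_continuous/derivable1_diffP.
  have eL : e n <= e n <= 1 - e n by have := e3 n; have := e0 n; lra.
  have eR : e n <= 1 - e n <= 1 - e n by have := e3 n; have := e0 n; lra.
  rewrite EFinB; apply: continuous_FTC2.
  - by have := e3 n; have := e0 n; lra.
  - apply: continuous_in_subspaceT => r; rewrite inE/= in_itv/= => /E01.
    exact: fc.
  - split.
    + by move=> r; rewrite in_itv/= => /andP[h1 h2]; apply: dF'; rewrite !ltW.
    + by apply: cvg_at_right_filter; exact: cF.
    + by apply: cvg_at_left_filter; exact: cF.
  - move=> r; rewrite in_itv/= => /andP[h1 h2].
    have /E01 /dF ? : e n <= r <= 1 - e n by rewrite !ltW.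
    by rewrite derive1E derive_val.
have mf : measurable_fun (`]0, 1[%classic : set R) f.
  apply: open_continuous_measurable_fun => // r; rewrite inE/= in_itv/=.
  exact: fc.
have cv : (\int[mu]_(x in E i) (f x)%:E @[i --> \oo] -->
    \int[mu]_(x in \bigcup_i E i) (f x)%:E)%E.
  apply: ge0_nondecreasing_set_cvg_integral.
  - apply/nondecreasing_seqP => n; rewrite subsetEset => r; rewrite /E /= !in_itv/=.
    have : e n.+1 <= e n by rewrite lef_pV2 ?posrE ?ltr0n// ler_nat.
    by move=> ? /andP[? ?]; apply/andP; split; lra.
  - by move=> n; exact: measurable_itv.
  - move=> n; apply/measurable_EFinP; apply: (measurable_funS _ _ mf) => //.
    by move=> r; rewrite /E /= !in_itv/=; exact: E01.
  - by move=> n r; rewrite /E /= in_itv/= => /E01 /f0; rewrite lee_fin.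
apply: cvge_le cv; apply: nearW => n; rewrite FTC lee_fin; apply: FM.
  by apply: (E01 n); have := e3 n; have := e0 n; lra.
by apply: (E01 n); have := e3 n; have := e0 n; lra.
Qed.

(* For [t = 1] this is the Beta(1/2, 1/2) kernel; in general its primitive is
   [2 * atan (t * sqrt (r / (1 - r)))], so that its integral is at most [pi]
   uniformly in [t]. *)
Definition arcsine_kernel t r : R :=
  (Num.sqrt r * Num.sqrt (1 - r))^-1 * (t / (1 - r + t ^+ 2 * r)).

Lemma arcsine_kernel_ge0 t r : 0 < t -> 0 < r < 1 -> 0 <= arcsine_kernel t r.
Proof.
move=> t0 /andP[r0 r1]; rewrite mulr_ge0// ?invr_ge0 ?mulr_ge0// ?ltW//.
by rewrite invr_gt0 addr_gt0 ?subr_gt0// mulr_gt0// exprn_gt0.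
Qed.

Lemma continuous_arcsine_kernel t r : 0 < t -> 0 < r < 1 ->
  {for r, continuous (arcsine_kernel t)}.
Proof.
move=> t0 /andP[r0 r1].
have c1 : {for r, continuous (fun x : R => 1 - x)}.
  by apply: cvgB; [exact: cvg_cst|exact: cvg_id].
apply: cvgM.
  apply: cvgV; first by rewrite mulf_neq0// gt_eqF// sqrtr_gt0// subr_gt0.
  apply: cvgM; first exact: sqrt_continuous.
  by apply: (continuous_comp c1); exact: sqrt_continuous.
apply: cvgM; first exact: cvg_cst.
apply: cvgV; first by rewrite gt_eqF// addr_gt0 ?subr_gt0// mulr_gt0// exprn_gt0.
apply: cvgD => //; apply: cvgM; [exact: cvg_cst|exact: cvg_id].
Qed.

Lemma is_derive_atan_odds t r : 0 < t -> 0 < r < 1 ->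
  is_derive r 1 (fun x : R => 2 * atan (t * (Num.sqrt x / Num.sqrt (1 - x))))
    (arcsine_kernel t r).
Proof.
move=> t0 /andP[r0 r1].
have r1' : 0 < 1 - r by lra.
have s1 : 0 < Num.sqrt r by rewrite sqrtr_gt0.
have s2 : 0 < Num.sqrt (1 - r) by rewrite sqrtr_gt0.
have d1 := is_derive1_sqrt r0.
have d2 : is_derive r 1 (fun x : R => 1 - x) (- 1).
  apply: is_derive_eq.
  by rewrite add0r mul1r.
have d3 := @is_derive1_comp R Num.sqrt (fun x => 1 - x) r _ _
  (is_derive1_sqrt r1') d2.
have d4 := @is_deriveV R _ r _ 1 (lt0r_neq0 s2 : (Num.sqrt \o (fun x => 1 - x)) r != 0) d3.
have d5 := is_deriveM d1 d4.
have d6 := is_deriveZ t d5.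
have d7 := @is_derive1_comp R atan _ r _ _ (is_derive1_atan _) d6.
have d8 := is_deriveZ 2 d7.
apply: (is_derive_eq d8); rewrite /arcsine_kernel /GRing.scale/= !fctE.
have E1 := sqr_sqrtr (ltW r0); have E2 := sqr_sqrtr (ltW r1').
move: {d1 d2 d3 d4 d5 d6 d7 d8} (Num.sqrt r) (Num.sqrt (1 - r)) s1 s2 E1 E2.
move=> a b a0 b0 E1 E2; have E3 : a ^+ 2 + b ^+ 2 = 1 by rewrite E1 E2 addrC subrK.
rewrite -E2 -E1 -[t *: _]/(t * _).
(* Inserting the factor [a ^+ 2 + b ^+ 2 = 1] makes the identity homogeneous, hence one of rational
   functions in independent [a], [b] and [t]. *)
transitivity ((a ^+ 2 + b ^+ 2) * ((a * b)^-1 * (t / (b ^+ 2 + t ^+ 2 * a ^+ 2)))).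
  have h : 0 < b ^+ 2 + t ^+ 2 * a ^+ 2.
    by rewrite addr_gt0 ?mulr_gt0 ?exprn_gt0.
  by field; rewrite -exprMn in h; rewrite !gt_eqF.
by rewrite E3 mul1r.
Qed.

Lemma integral_arcsine_kernel_le t : 0 < t ->
  (\int[mu]_(r in `]0%R, 1%R[) (arcsine_kernel t r)%:E <= pi%:E)%E.
Proof.
move=> t0; apply: (integral01_le (F := fun x : R =>
    2 * atan (t * (Num.sqrt x / Num.sqrt (1 - x))))) => r.
- exact: arcsine_kernel_ge0.
- exact: continuous_arcsine_kernel.
- exact: is_derive_atan_odds.
move=> r' r01 r'01; set x := _ * _; set y := 2 * _.
have : x <= pi by rewrite /x mulrC -ler_pdivlMr// ltW// atan_ltpi2.
suff : 0 <= y by lra.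
rewrite /y mulr_ge0// -[leLHS](@atan0 R); apply: le_atan.
by apply: mulr_ge0; [exact: ltW|exact: divr_ge0].
Qed.

Lemma beta_kernel_half r : 0 < r < 1 ->
  beta_kernel (1 / 2) (1 / 2) r = arcsine_kernel 1 r.
Proof.
move=> /andP[r0 r1]; have r1' : 0 < 1 - r by lra.
rewrite /beta_kernel /arcsine_kernel expr1n !mul1r subrK invr1 mulr1.
have -> : 2^-1 - 1 = - 2^-1 :> R by field.
by rewrite !powRN !powR12_sqrt ?ltW// invfM.
Qed.

Lemma arcsine_kernelE t r : 0 < r < 1 ->
  arcsine_kernel t r = arcsine_kernel 1 r * (t / (1 - r + t ^+ 2 * r)).
Proof.
by move=> _; rewrite /arcsine_kernel expr1n !mul1r subrK invr1 mulr1.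
Qed.

Lemma arcsine_kernel1_ge1 r : 0 < r < 1 -> 1 <= arcsine_kernel 1 r.
Proof.
move=> /andP[r0 r1]; have r1' : 0 < 1 - r by lra.
rewrite /arcsine_kernel expr1n !mul1r subrK invr1 mulr1.
rewrite invf_ge1 ?mulr_gt0 ?sqrtr_gt0//.
by rewrite mulr_ile1 ?sqrtr_ge0// -[leRHS]sqrtr1 ler_sqrt//; lra.
Qed.

Lemma measurable_arcsine_kernel t : 0 < t ->
  measurable_fun (`]0, 1[%classic : set R) (arcsine_kernel t).
Proof.
move=> t0; apply: open_continuous_measurable_fun => // r; rewrite inE/= in_itv/=.
exact: continuous_arcsine_kernel.
Qed.

(** [beta_function] is the [fine] part of an integral, so finiteness has to come first. The upper
    bound is the total increment of the arctangent primitive, the lower one holds because the kernel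
    is at least [1]. *)
Lemma beta_function_half :
  [/\ (\int[mu]_(r in `]0%R, 1%R[) (beta_kernel (1/2) (1/2) r)%:E =
      (beta_function (1/2) (1/2) : R)%:E)%E,
    1 <= beta_function (1/2) (1/2) :> R & beta_function (1/2) (1/2) <= pi :> R].
Proof.
have E : (\int[mu]_(r in `]0%R, 1%R[) (beta_kernel (1/2) (1/2) r)%:E =
    \int[mu]_(r in `]0%R, 1%R[) (arcsine_kernel 1 r)%:E)%E.
  by apply: eq_integral => r; rewrite inE/= in_itv/= => /beta_kernel_half ->.
have le_pi := @integral_arcsine_kernel_le 1 ltr01.
have ge1 : (1%:E <= \int[mu]_(r in `]0%R, 1%R[) (arcsine_kernel 1 r)%:E)%E.
  apply: (@le_trans _ _ (\int[mu]_(r in `]0%R, 1%R[) (cst 1%:E r))%E).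
    rewrite integral_cst//= lebesgue_measure_itv/= lte_fin ltr01.
    by rewrite oppr0 adde0 mule1.
  apply: le_integral_pointwise => r /=; rewrite in_itv/= lee_fin.
  exact: arcsine_kernel1_ge1.
have fin : (\int[mu]_(r in `]0%R, 1%R[) (beta_kernel (1/2) (1/2) r)%:E)%E \is a fin_num.
  rewrite E ge0_fin_numE; first by rewrite (le_lt_trans le_pi)// ltry.
  by apply: le_trans ge1; rewrite lee_fin.
have EB : (\int[mu]_(r in `]0%R, 1%R[) (beta_kernel (1/2) (1/2) r)%:E =
      (beta_function (1/2) (1/2) : R)%:E)%E by rewrite /beta_function fineK.
by split=> //; rewrite -lee_fin -EB E.
Qed.

Lemma beta_dens_half r : 0 < r < 1 ->
  beta_dens (1/2) (1/2) r = arcsine_kernel 1 r / beta_function (1/2) (1/2).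
Proof. by move=> r01; rewrite /beta_dens r01 beta_kernel_half. Qed.

Lemma beta_function_half_gt0 : 0 < beta_function (1/2) (1/2) :> R.
Proof. by have [_ + _] := beta_function_half; exact: lt_le_trans. Qed.

Lemma integral_beta_dens_half :
  (\int[mu]_(r in `]0%R, 1%R[) (beta_dens (1/2) (1/2) r)%:E = 1)%E.
Proof.
have [EB B1 _] := beta_function_half.
transitivity (\int[mu]_(r in `]0%R, 1%R[)
   ((beta_function (1/2) (1/2))^-1%:E * (arcsine_kernel 1 r)%:E))%E.
  apply: eq_integral => r; rewrite inE/= in_itv/= => r01.
  by rewrite beta_dens_half// EFinM muleC.
rewrite ge0_integralZl//.
- rewrite [X in (_ * X)%E](_ : _ = (beta_function (1/2) (1/2) : R)%:E).
    by rewrite -EFinM mulVf// gt_eqF// beta_function_half_gt0.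
  by rewrite -EB; apply: eq_integral => r; rewrite inE/= in_itv/= => /beta_kernel_half ->.
- by apply/measurable_EFinP; exact: measurable_arcsine_kernel.
- by move=> r /=; rewrite in_itv/= lee_fin; exact: arcsine_kernel_ge0.
- by rewrite lee_fin invr_ge0 ltW// beta_function_half_gt0.
Qed.

End BetaIntegrals.

(** * The marginal prior of an off-diagonal entry *)


Section ShrinkagePrior.
Context {R : realType}.
Local Notation mu := (@lebesgue_measure R).

(* [powR] replaces inverses and square roots because its measurability holds on
   the whole line, which is what joint measurability in [(x, s)] requires. *)
Let normal_pdf_powR (s x : R) : 0 < s -> normal_pdf 0 s x =
  (s ^+ 2 * pi *+ 2) `^ (- 2^-1) * expR (- x ^+ 2 * (s ^+ 2 *+ 2) `^ (-1)).
Proof.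
move=> s0; rewrite normal_pdfE ?gt_eqF// /normal_peak /normal_fun subr0.
have h : 0 <= s ^+ 2 *+ 2 by rewrite mulrn_wge0// sqr_ge0.
have h2 : 0 <= s ^+ 2 * pi *+ 2 by rewrite mulrn_wge0// mulr_ge0 ?sqr_ge0 ?pi_ge0.
by rewrite powRN powR12_sqrt// powR_inv1.
Qed.

(** Extending [s] and [w] by zero outside [D] gives a jointly measurable function on the plane, and
    Tonelli applies. The weight [w] need not have mass [1]: the tail estimate uses one with mass of
    order [T / d]. *)
Lemma normal_mixture (D : set R) (s w : R -> R) : measurable D ->
  measurable_fun D s -> measurable_fun D w ->
  (forall r, D r -> 0 < s r) -> (forall r, D r -> 0 <= w r) ->
  measurable_fun [set: R]
    (fun x => \int[mu]_(r in D) (normal_pdf 0 (s r) x * w r)%:E)%E /\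
  (\int[mu]_x \int[mu]_(r in D) (normal_pdf 0 (s r) x * w r)%:E =
   \int[mu]_(r in D) (w r)%:E)%E.
Proof.
move=> mD ms mw s0 w0.
pose s' := s \_ D; pose w' := w \_ D.
have ms' : measurable_fun [set: R] s' by apply/(measurable_restrictT s mD).
have mw' : measurable_fun [set: R] w' by apply/(measurable_restrictT w mD).
pose phi (z : R * R) : \bar R := ((s' z.2 ^+ 2 * pi *+ 2) `^ (- 2^-1) *
   expR (- z.1 ^+ 2 * (s' z.2 ^+ 2 *+ 2) `^ (-1)) * w' z.2)%:E.
have w'0 r : 0 <= w' r by rewrite /w' patchE; case: ifPn => // /set_mem /w0.
have phi0 z : (0 <= phi z)%E.
  by rewrite lee_fin mulr_ge0// mulr_ge0 ?powR_ge0 ?expR_ge0.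
have mphi : measurable_fun [set: R * R] phi.
  have m2 : measurable_fun [set: R * R] (fun z : R * R => s' z.2 ^+ 2 *+ 2).
    have -> : (fun z : R * R => s' z.2 ^+ 2 *+ 2) = (fun z => s' z.2 ^+ 2 * 2).
      by apply/funext => z /=; rewrite mulr_natr.
    apply: measurable_funM => //; apply: measurable_funX.
    exact: measurableT_comp.
  have m3 : measurable_fun [set: R * R] (fun z : R * R => s' z.2 ^+ 2 * pi *+ 2).
    have -> : (fun z : R * R => s' z.2 ^+ 2 * pi *+ 2) =
       (fun z : R * R => (s' z.2 ^+ 2 *+ 2) * pi).
      by apply/funext => z; rewrite mulrnAl.
    exact: measurable_funM.
  apply/measurable_EFinP; apply: measurable_funM; last exact: measurableT_comp.
  apply: measurable_funM.
    by apply: (measurableT_comp (measurable_powR _)).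
  apply: measurableT_comp => //; apply: measurable_funM.
    apply: measurableT_comp => //; apply: measurable_funX; exact: measurable_fst.
  by apply: (measurableT_comp (measurable_powR _)).
have E x : (\int[mu]_(r in D) (normal_pdf 0 (s r) x * w r)%:E =
    \int[mu]_r phi (x, r))%E.
  rewrite integral_mkcond; apply: eq_integral => r _.
  rewrite /phi/= /s' /w' !patchE; case: ifPn => [/set_mem Dr|_].
    by rewrite normal_pdf_powR// s0.
  by rewrite mulr0.
split.
  rewrite (_ : (fun x => _) = fubini_F mu phi); last by apply/funext => x; rewrite E.
  exact: measurable_fun_fubini_tonelli_F.
under eq_integral do rewrite E.
rewrite fubini_tonelli// [RHS]integral_mkcond; apply: eq_integral => r _.
rewrite /phi/= /s' /w' !patchE; case: ifPn => [/set_mem Dr|_]; last first.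
  by under eq_integral do rewrite mulr0; rewrite integral0.
under eq_integral => x _ do rewrite -normal_pdf_powR ?s0// EFinM muleC.
rewrite ge0_integralZl//; last 3 first.
- by apply/measurable_EFinP; exact: measurable_normal_pdf.
- by move=> x _; rewrite lee_fin normal_pdf_ge0.
- by rewrite lee_fin w0.
by rewrite integral_normal_pdf mule1.
Qed.

(** With [t = T / d] and [s ^ 2 = r / (1 - r) * T ^ 2], the ratio [s ^ 2 / (s ^ 2 + d ^ 2)] equals
    [r * t * (t / (1 - r + t ^ 2 * r))]. Bounding [r] by [1] leaves [t] times the factor that turns
    [arcsine_kernel 1] into [arcsine_kernel t]. *)
Let tail_algebra (T d r B k : R) : 0 < T -> 0 < d -> 0 < r -> 0 < 1 - r ->
  0 < B -> 0 <= k ->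
  8 * (r / (1 - r) * T ^+ 2 / (r / (1 - r) * T ^+ 2 + d ^+ 2)) * (k / B) <=
  8 * (T / d) / B * (k * ((T / d) / (1 - r + (T / d) ^+ 2 * r))).
Proof.
move=> T0 d0 r0 r1 B0 k0.
have T2 : 0 < T ^+ 2 by rewrite exprn_gt0.
have d2 : 0 < d ^+ 2 by rewrite exprn_gt0.
set c := (X in _ <= X).
have -> : 8 * (r / (1 - r) * T ^+ 2 / (r / (1 - r) * T ^+ 2 + d ^+ 2)) * (k / B) = r * c;
  last first.
  rewrite ler_piMl//; last by lra.
  apply: mulr_ge0; first by rewrite ltW// divr_gt0// mulr_gt0// divr_gt0.
  apply: mulr_ge0 => //; rewrite ltW// divr_gt0 ?divr_gt0//.
  by rewrite addr_gt0// mulr_gt0// exprn_gt0// divr_gt0.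
have h1 : 0 < r * T ^+ 2 + d ^+ 2 * (1 - r) by rewrite addr_gt0 ?mulr_gt0.
have h2 : 0 < (1 - r) * d ^+ 2 + T ^+ 2 * r by rewrite addr_gt0 ?mulr_gt0.
by rewrite /c; field; rewrite !gt_eqF.
Qed.

Let pi_le4 : pi <= 4 :> R.
Proof. by have := @pihalf_lt2 R; lra. Qed.

Section Offdiag.
Variable T : R.
Hypothesis T0 : 0 < T.

Let scale r : R := Num.sqrt (r / (1 - r) * T ^+ 2).
Let D := (`]0, 1[%classic : set R).

Let mscale : measurable_fun D scale.
Proof.
apply: (eq_measurable_fun (fun r : R => (r * (1 - r) `^ (-1) * T ^+ 2) `^ 2^-1)).
  move=> r; rewrite inE /D/= in_itv/= => /andP[r0 r1].
  have r1' : 0 < 1 - r by lra.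
  rewrite powR_inv1 ?ltW// powR12_sqrt//.
  by rewrite mulr_ge0 ?sqr_ge0// divr_ge0// ltW.
apply: measurable_funTS; apply: (measurableT_comp (measurable_powR _)).
apply: measurable_funM => //; apply: measurable_funM => //.
by apply: (measurableT_comp (measurable_powR _)); exact: measurable_funB.
Qed.

Let scale_gt0 r : D r -> 0 < scale r.
Proof.
rewrite /D/= in_itv/= => /andP[r0 r1]; have r1' : 0 < 1 - r by lra.
by rewrite sqrtr_gt0 mulr_gt0// ?exprn_gt0// divr_gt0.
Qed.

Let beta_dens_ge0 r : D r -> 0 <= beta_dens (1/2) (1/2) r :> R.
Proof.
rewrite /D/= in_itv/= => r01; rewrite beta_dens_half// divr_ge0//.
  exact: arcsine_kernel_ge0.
by rewrite ltW// beta_function_half_gt0.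
Qed.

Let mbeta_dens : measurable_fun D (beta_dens (1/2) (1/2) : R -> R).
Proof.
apply: (eq_measurable_fun
   (fun r : R => arcsine_kernel 1 r / beta_function (1/2) (1/2))).
  by move=> r; rewrite inE /D/= in_itv/= => /beta_dens_half ->.
by apply: measurable_funM => //; exact: measurable_arcsine_kernel.
Qed.

Lemma measurable_offdiag_dens :
  measurable_fun [set: R] (offdiag_dens (1/2) (1/2) (T ^+ 2)).
Proof. by have [] := normal_mixture (measurable_itv _) mscale mbeta_dens scale_gt0 beta_dens_ge0. Qed.

Lemma offdiag_dens_ge0 x : (0 <= offdiag_dens (1/2) (1/2) (T ^+ 2) x)%E.
Proof.
apply: integral_ge0 => r Dr; rewrite lee_fin mulr_ge0 ?normal_pdf_ge0//.
exact: beta_dens_ge0.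
Qed.

Lemma integral_offdiag_dens :
  (\int[mu]_x offdiag_dens (1/2) (1/2) (T ^+ 2) x = 1)%E.
Proof.
have [_ ->] := normal_mixture (measurable_itv _) mscale mbeta_dens scale_gt0 beta_dens_ge0.
exact: integral_beta_dens_half.
Qed.

(* Half of the Gaussian exponent is bounded on [d <= `|x|] by its value at [d],
   the other half is kept and gives a Gaussian with variance [2 * s ^+ 2]. *)
Let normal_pdf_tail (d s x : R) : 0 < d -> 0 < s -> d <= `|x| ->
  normal_pdf 0 s x <=
    8 * (s ^+ 2 / (s ^+ 2 + d ^+ 2)) * normal_pdf 0 (Num.sqrt 2 * s) x.
Proof.
move=> d0 s0 dx.
have q0 : 0 < Num.sqrt (2 : R) by rewrite sqrtr_gt0.
have q2 : Num.sqrt (2 : R) ^+ 2 = 2 by rewrite sqr_sqrtr.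
have qs : 0 < Num.sqrt 2 * s by rewrite mulr_gt0.
rewrite !normal_pdfE ?gt_eqF// /normal_peak /normal_fun !subr0 exprMn q2.
have -> : 2 * s ^+ 2 * pi *+ 2 = 2 * (s ^+ 2 * pi *+ 2) by rewrite mulrnAr mulrA.
set P := s ^+ 2 * pi *+ 2; have P0 : 0 < P by rewrite pmulrn_lgt0// mulr_gt0 ?exprn_gt0 ?pi_gt0.
rewrite sqrtrM//; set S := Num.sqrt P; have S0 : 0 < S by rewrite sqrtr_gt0.
have -> : - x ^+ 2 / (s ^+ 2 *+ 2) = - (x ^+ 2 / (4 * s ^+ 2)) - x ^+ 2 / (4 * s ^+ 2).
  by rewrite -mulr_natr; field; rewrite gt_eqF.
have -> : - x ^+ 2 / (2 * s ^+ 2 *+ 2) = - (x ^+ 2 / (4 * s ^+ 2)).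
  by rewrite -mulr_natr; field; rewrite gt_eqF.
set u := x ^+ 2 / (4 * s ^+ 2); rewrite expRD.
have s20 : 0 < s ^+ 2 by rewrite exprn_gt0.
have d20 : 0 < d ^+ 2 by rewrite exprn_gt0.
have hu : d ^+ 2 / (4 * s ^+ 2) <= u.
  rewrite ler_pM2r ?invr_gt0 ?mulr_gt0//.
  by rewrite -[leRHS]real_normK ?num_real// ler_pXn2r// ?nnegrE// ltW.
(* From [exp (- u) <= 1 / (1 + u)]. This takes a factor [4] of the constant [8]; the other [2] pays
   for the peak of the wider Gaussian, lower by [Num.sqrt 2]. *)
have he : expR (- u) <= 4 * (s ^+ 2 / (s ^+ 2 + d ^+ 2)).
  rewrite expRN; apply: (@le_trans _ _ (1 + d ^+ 2 / (4 * s ^+ 2))^-1).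
    rewrite lef_pV2 ?posrE ?expR_gt0//; last by rewrite addr_gt0// divr_gt0// mulr_gt0.
    by apply: le_trans (expR_ge1Dx u); rewrite lerD2l.
  have -> : (1 + d ^+ 2 / (4 * s ^+ 2))^-1 = 4 * (s ^+ 2 / (4 * s ^+ 2 + d ^+ 2)).
    by field; rewrite !gt_eqF ?addr_gt0 ?mulr_gt0 ?divr_gt0.
  rewrite ler_pM2l// ler_pM2l// lef_pV2 ?posrE ?addr_gt0 ?mulr_gt0//.
  by rewrite lerD2r ler_peMl ?ltW//; lra.
have q2' : Num.sqrt (2 : R) <= 2.
  by rewrite -(@ler_pXn2r _ 2) ?nnegrE ?ltW// q2; lra.
rewrite invfM.
have -> : 8 * (s ^+ 2 / (s ^+ 2 + d ^+ 2)) * ((Num.sqrt 2)^-1 * S^-1 * expR (- u)) =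
  S^-1 * (expR (- u) * ((2 / Num.sqrt 2) * (4 * (s ^+ 2 / (s ^+ 2 + d ^+ 2))))).
  by field; rewrite !gt_eqF ?addr_gt0.
rewrite ler_pM2l ?invr_gt0// ler_pM2l ?expR_gt0//.
apply: (le_trans he); rewrite ler_peMl//.
  by rewrite mulr_ge0// divr_ge0 ?ltW ?addr_gt0.
by rewrite ler_pdivlMr// mul1r.
Qed.

(** Outside the interval the mixture is dominated by a mixture of wider Gaussians, whose integral
    over the whole line is the mass of its weight [w]. The constant is [32 = 8 * 4], by [pi <= 4]
    and [1 <= beta_function (1/2) (1/2)]. The decay is only of order [T / d] because
    [sqrt (r / (1 - r))] is half-Cauchy, as in the horseshoe prior. *)
Lemma offdiag_dens_tail (d : R) : 0 < d ->
  (\int[mu]_(x in ~` `[(- d)%R, d]) offdiag_dens (1/2) (1/2) (T ^+ 2) x <=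
    (32 * (T / d))%:E)%E.
Proof.
move=> d0; pose t := T / d; have t0 : 0 < t by rewrite divr_gt0.
pose w r := 8 * t / beta_function (1/2) (1/2) * arcsine_kernel t r.
have B0 := @beta_function_half_gt0 R.
have w0 r : D r -> 0 <= w r.
  rewrite /D/= in_itv/= => r01; apply: mulr_ge0; last exact: arcsine_kernel_ge0.
  by apply: divr_ge0; [apply: mulr_ge0 => //; exact: ltW|exact: ltW].
have mw : measurable_fun D w.
  by apply: measurable_funM => //; exact: measurable_arcsine_kernel.
have ms2 : measurable_fun D (fun r => Num.sqrt 2 * scale r) by exact: measurable_funM.
have s2_gt0 r : D r -> 0 < Num.sqrt 2 * scale r.
  by move=> /scale_gt0 ?; rewrite mulr_gt0// sqrtr_gt0.
have [_ mix] := normal_mixture (measurable_itv _) ms2 mw s2_gt0 w0.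
have pw x r : ~ `[- d, d]%classic x -> D r ->
    normal_pdf 0 (scale r) x * beta_dens (1/2) (1/2) r <=
    normal_pdf 0 (Num.sqrt 2 * scale r) x * w r.
  move=> xd Dr; have dx : d <= `|x|.
    rewrite leNgt; apply/negP => xd'; apply: xd.
    by rewrite /= in_itv/= -ler_norml ltW.
  apply: le_trans (ler_wpM2r (beta_dens_ge0 Dr) (normal_pdf_tail d0 (scale_gt0 Dr) dx)) _.
  rewrite mulrAC [leRHS]mulrC ler_wpM2r ?normal_pdf_ge0//.
  move: Dr; rewrite /D/= in_itv/= => r01; rewrite beta_dens_half// /w (arcsine_kernelE t r01).
  have /andP[r0 r1] := r01; have r1' : 0 < 1 - r by lra.
  have -> : scale r ^+ 2 = r / (1 - r) * T ^+ 2.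
    by rewrite sqr_sqrtr// mulr_ge0 ?sqr_ge0// divr_ge0// ltW.
  by apply: tail_algebra => //; exact: arcsine_kernel_ge0.
apply: (@le_trans _ _ (\int[mu]_x \int[mu]_(r in D)
    (normal_pdf 0 (Num.sqrt 2 * scale r) x * w r)%:E)%E).
  rewrite integral_mkcond; apply: le_integral_pointwise => x _; rewrite patchE.
  case: ifPn => [/set_mem xd|_].
    by apply: le_integral_pointwise => r Dr; rewrite lee_fin; exact: pw.
  by apply: integral_ge0 => r Dr; rewrite lee_fin mulr_ge0 ?normal_pdf_ge0// w0.
rewrite mix; under eq_integral do rewrite /w EFinM.
have c0 : 0 <= 8 * t / beta_function (1/2) (1/2) by rewrite ltW// divr_gt0// mulr_gt0.
rewrite ge0_integralZl//; last 2 first.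
- by apply/measurable_EFinP; exact: measurable_arcsine_kernel.
- by move=> r; rewrite /D/= in_itv/= lee_fin; exact: arcsine_kernel_ge0.
apply: le_trans (lee_wpmul2l _ (integral_arcsine_kernel_le t0)) _; first by rewrite lee_fin.
rewrite -EFinM lee_fin -/t.
apply: (@le_trans _ _ (8 * t * 4)); last by rewrite mulrAC; lra.
have hb : 8 * t / beta_function (1/2) (1/2) <= 8 * t.
  have t8 : 0 <= 8 * t by apply: mulr_ge0 => //; exact: ltW.
  by rewrite ler_pdivrMr// ler_peMr//; have [] := @beta_function_half R.
by apply: ler_pM hb pi_le4 => //; exact: pi_ge0.
Qed.

Lemma integral_offdiag_dens_center (d : R) : 0 < d ->
  ((1 - 32 * (T / d))%:E <=
   \int[mu]_(x in `[(- d)%R, d]) offdiag_dens (1/2) (1/2) (T ^+ 2) x)%E.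
Proof.
move=> d0; have := integral_offdiag_dens.
rewrite -(setUv `[(- d)%R, d]) ge0_integral_setU//; last 4 first.
- exact: measurableC.
- by rewrite setUv; exact: measurable_offdiag_dens.
- by move=> x _; exact: offdiag_dens_ge0.
- by apply/disj_setPS; rewrite setICr.
have := offdiag_dens_tail d0; set I := integral _ _ _; set J := integral _ _ _.
have J0 : (0 <= J)%E by apply: integral_ge0 => x _; exact: offdiag_dens_ge0.
have I0 : (0 <= I)%E by apply: integral_ge0 => x _; exact: offdiag_dens_ge0.
case: I I0 => [i| |] //; case: J J0 => [j| |] //; rewrite !lee_fin => _ _ h [h2].
by lra.
Qed.

(** Only those [r] count for which the standard deviation lies between [1] and [2]; [r1] and [r2]
    solve [scale r = 1] and [scale r = 2]. There [1 - r <= T ^+ 2], so the Beta density is at least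
    [1 / (4 * T)], and the window has length at least [3 / 10 * T ^+ 2]; the product is
    [3 / 40 * T]. *)
Lemma offdiag_dens_lower (X x : R) : T <= 1 -> `|x| <= X ->
  ((normal_peak 2 * expR (- X ^+ 2 / 2) * (3 / 40) * T)%:E <=
   offdiag_dens (1/2) (1/2) (T ^+ 2) x)%E.
Proof.
move=> T1 xX.
have T20 : 0 < T ^+ 2 by rewrite exprn_gt0.
have T21 : T ^+ 2 <= 1 by rewrite exprn_ile1// ltW.
pose r1 := (1 + T ^+ 2)^-1; pose r2 := 4 / (4 + T ^+ 2).
pose c := normal_peak 2 * expR (- X ^+ 2 / 2).
have c0 : 0 <= c by rewrite mulr_ge0 ?expR_ge0// normal_peak_ge0.
have B0 := @beta_function_half_gt0 R.
have B4 : beta_function (1/2) (1/2) <= 4 :> R.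
  by have [_ _ h] := @beta_function_half R; rewrite (le_trans h)// pi_le4.
have sub r : r1 <= r <= r2 -> [/\ D r, 1 <= scale r <= 2 & 1 - r <= T ^+ 2].
  move=> /andP[h1 h2].
  have r0 : 0 < r by apply: lt_le_trans h1; rewrite invr_gt0; lra.
  move: h1; rewrite /r1 -[leRHS]invrK lef_pV2 ?posrE ?invr_gt0//; last by lra.
  rewrite -[X in X <= _]mul1r ler_pdivrMr// => h1.
  move: h2; rewrite /r2 ler_pdivlMr; last by lra.
  move=> h2.
  have r11 : r < 1 by nra.
  have r1' : 0 < 1 - r by lra.
  split; first by rewrite /D/= in_itv/= r0.
  - have hs : 1 ^+ 2 <= scale r ^+ 2 <= 2 ^+ 2.
      rewrite sqr_sqrtr; last by rewrite mulr_ge0 ?divr_ge0 ?ltW.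
      rewrite mulrAC ler_pdivlMr// ler_pdivrMr//; apply/andP; split; nra.
    have sc : 0 <= scale r := sqrtr_ge0 _.
    by move: hs; rewrite ler_pXn2r ?nnegrE// ler_pXn2r ?nnegrE.
  - nra.
have pw r : r1 <= r <= r2 ->
    c / (4 * T) <= normal_pdf 0 (scale r) x * beta_dens (1/2) (1/2) r.
  move=> /sub[Dr /andP[s1 s2] h].
  have s0 := scale_gt0 Dr.
  apply: ler_pM => //; first by rewrite invr_ge0 mulr_ge0 ?ltW.
    rewrite normal_pdfE ?gt_eqF// /normal_peak /normal_fun subr0.
    apply: ler_pM; rewrite ?invr_ge0 ?sqrtr_ge0 ?expR_ge0//.
      rewrite lef_pV2 ?posrE ?sqrtr_gt0 ?pmulrn_lgt0 ?mulr_gt0 ?exprn_gt0 ?pi_gt0//.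
      rewrite ler_sqrt ?pmulrn_lge0 ?mulr_ge0 ?exprn_ge0 ?pi_ge0//.
      by rewrite ler_pMn2r// ler_pM2r ?pi_gt0// ler_pXn2r ?nnegrE// ltW.
    rewrite ler_expR !mulNr lerN2; apply: ler_pM; rewrite ?sqr_ge0 ?invr_ge0//.
      by rewrite mulrn_wge0// sqr_ge0.
      by rewrite -[leLHS]real_normK ?num_real// ler_pXn2r ?nnegrE// (le_trans _ xX).
    rewrite lef_pV2 ?posrE ?pmulrn_lgt0 ?exprn_gt0//.
    by rewrite -[leLHS]/(1 *+ 2) ler_pMn2r// exprn_ege1.
  move: Dr; rewrite /D/= in_itv/= => r01; rewrite beta_dens_half//.
  rewrite invfM mulrC; apply: ler_pM; rewrite ?invr_ge0//; first exact: ltW; last first.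
    by rewrite lef_pV2 ?posrE.
  have /andP[r0 r1'] := r01.
  rewrite /arcsine_kernel expr1n !mul1r subrK invr1 mulr1.
  have q1 : 0 < Num.sqrt r by rewrite sqrtr_gt0.
  have q2 : 0 < Num.sqrt (1 - r) by rewrite sqrtr_gt0 subr_gt0.
  rewrite lef_pV2 ?posrE ?mulr_gt0//.
  apply: (@le_trans _ _ (1 * Num.sqrt (1 - r))).
    rewrite ler_pM2r// -[leRHS]sqrtr1 ler_sqrt//; lra.
  by rewrite mul1r -(gtr0_norm T0) -sqrtr_sqr ler_sqrt// ltW.
have r12 : r1 <= r2.
  rewrite /r1 /r2 -[X in X <= _]mul1r ler_pdivrMr; last by lra.
  by rewrite mulrAC ler_pdivlMr; lra.
have len : 3 / 10 * T ^+ 2 <= r2 - r1.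
  have -> : r2 - r1 = 3 * T ^+ 2 / ((1 + T ^+ 2) * (4 + T ^+ 2)).
    by rewrite /r1 /r2; field; rewrite !gt_eqF//; lra.
  rewrite ler_pdivlMr; last by rewrite mulr_gt0; lra.
  nra.
apply: (@le_trans _ _ (\int[mu]_(r in `[r1, r2]) cst (c / (4 * T))%:E r)%E).
  rewrite integral_cst//= lebesgue_measure_itv/= lte_fin.
  have r12' : r1 < r2 by nra.
  rewrite r12' -EFinB -EFinM lee_fin.
  apply: (@le_trans _ _ (c / (4 * T) * (3 / 10 * T ^+ 2))).
    rewrite le_eqVlt; apply/orP; left; apply/eqP; rewrite -/c.
    by field; rewrite gt_eqF.
  by rewrite ler_wpM2l// divr_ge0// mulr_ge0// ltW.
rewrite integral_mkcond [leRHS]integral_mkcond.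
apply: le_integral_pointwise => r _; rewrite !patchE.
case: ifPn => [/set_mem/=|_].
  rewrite in_itv/= => r12'; have [Dr _ _] := sub _ r12'.
  by rewrite mem_set// lee_fin; exact: pw.
case: ifPn => // /set_mem Dr; rewrite lee_fin mulr_ge0 ?normal_pdf_ge0//.
exact: beta_dens_ge0.
Qed.

End Offdiag.
End ShrinkagePrior.

(** * Prior mass of a box *)


Section TriangularIndex.

(* Left inverse of [tri_idx] on the pairs [j <= k], which are enumerated column
   by column. *)
Fixpoint tri_decode (n : nat) : nat * nat :=
  if n is n'.+1 then
    let: (j, k) := tri_decode n' in if (j < k)%N then (j.+1, k) else (0%N, k.+1)
  else (0%N, 0%N).

Lemma tri_decodeK j k : (j <= k)%N -> tri_decode (tri_idx j k) = (j, k).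
Proof.
rewrite /tri_idx; elim: k j => [|k IHk]; first by case.
elim=> [_|j IHj jk].
  have -> : ('C(k.+2, 2) + 0 = ('C(k.+1, 2) + k).+1)%N.
    by rewrite addn0 binS bin1 addnS.
  by rewrite /= IHk// ltnn.
by rewrite addnS /= IHj ?(ltnW jk)// jk.
Qed.

Lemma big_tri (V : Type) (idx : V) (op : Monoid.com_law idx) p (F : nat -> V) :
  \big[op/idx]_(i < tri_dim p) F i =
  \big[op/idx]_(k < p) \big[op/idx]_(j < k.+1) F (tri_idx j k).
Proof.
elim: p => [|p IH]; first by rewrite !big_ord0.
rewrite big_ord_recr/= -IH -!(big_mkord xpredT F) /tri_dim binS bin1.
rewrite (@big_cat_nat _ _ _ 'C(p.+1, 2))//= ?leq_addr//; congr (op _ _).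
rewrite -{1}['C(p.+1, 2)]add0n big_addn addKn big_mkord.
by apply: eq_bigr => j _; rewrite /tri_idx addnC.
Qed.

Lemma big_tri_diag (V : Type) (idx : V) (op : Monoid.com_law idx) p
  (F : nat -> nat -> V) (G : nat -> V) :
  op (\big[op/idx]_(k < p) \big[op/idx]_(j < p | (j < k)%N) F j k)
     (\big[op/idx]_(j < p) G j) =
  \big[op/idx]_(k < p) \big[op/idx]_(j < k.+1)
    (if (j < k)%N then F j k else G k).
Proof.
rewrite -big_split; apply: eq_bigr => k _; rewrite big_ord_recr/= ltnn.
congr (op _ _); rewrite -(big_ord_widen _ (fun j => F j k)) 1?ltnW//.
by apply: eq_bigr => j _; rewrite ltn_ord.
Qed.

End TriangularIndex.

Section PriorMass.
Context {R : realType}.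
Local Notation mu := (@lebesgue_measure R).

Lemma le_prode (I : Type) (s : seq I) (P : pred I) (f g : I -> \bar R) :
  (forall i, P i -> 0 <= f i)%E -> (forall i, P i -> f i <= g i)%E ->
  (\prod_(i <- s | P i) f i <= \prod_(i <- s | P i) g i)%E.
Proof.
move=> f0 fg; elim: s => [|i s IH]; first by rewrite !big_nil.
rewrite !big_cons; case: ifPn => // Pi; apply: lee_pmul => //.
- exact: f0.
- exact: prode_ge0.
- exact: fg.
Qed.

Lemma iint_tri p (h : nat -> nat -> R -> \bar R) :
  (forall j k, measurable_fun [set: R] (h j k)) ->
  (forall j k x, 0 <= h j k x)%E ->
  iint (tri_dim p) (fun s =>
    \prod_(k < p) \prod_(j < k.+1) h j k (nth 0%R s (tri_idx j k)))%E =
  (\prod_(k < p) \prod_(j < k.+1) \int[mu]_x h j k x)%E.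
Proof.
move=> mh h0; pose H i := h (tri_decode i).1 (tri_decode i).2.
have HE j k : (j < k.+1)%N -> H (tri_idx j k) = h j k.
  by rewrite ltnS => jk; rewrite /H tri_decodeK.
have := @iint_prod R (tri_dim p) 1%E H lee01 (fun i => mh _ _) (fun i => h0 _ _).
under eq_iint do rewrite mul1e.
rewrite mul1e (big_tri _ _ (fun i => \int[mu]_x H i x)%E).
under eq_bigr => k _ do under eq_bigr => j _ do rewrite HE//.
move=> <-; apply: eq_iint => s _.
rewrite (big_tri _ _ (fun i => H i (nth 0 s i))).
by apply: eq_bigr => k _; apply: eq_bigr => j _; rewrite HE.
Qed.

Section Bounds.
Variables (p : nat) (T lam : R).
Hypotheses (T0 : 0 < T) (lam0 : 0 < lam).

Let od := offdiag_dens (1/2) (1/2) (T ^+ 2).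
Let g (j k : nat) : R -> \bar R := if (j < k)%N then od else diag_dens lam.

Let mg j k : measurable_fun [set: R] (g j k).
Proof.
rewrite /g; case: ifP => _; first exact: measurable_offdiag_dens.
by apply/measurable_EFinP; exact: measurable_exponential_pdf.
Qed.

Let g0 j k x : (0 <= g j k x)%E.
Proof.
rewrite /g; case: ifP => _; first exact: offdiag_dens_ge0.
by rewrite lee_fin exponential_pdf_ge0// divr_ge0// ltW.
Qed.

Let prior_u_densE s : prior_u_dens p (1/2) (1/2) (T ^+ 2) lam s =
  (\prod_(k < p) \prod_(j < k.+1) g j k (nth 0%R s (tri_idx j k)))%E.
Proof.
rewrite /prior_u_dens (big_tri_diag _ p (fun j k => od (nth 0%R s (tri_idx j k)))
  (fun j => diag_dens lam (nth 0%R s (tri_idx j j)))).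
apply: eq_bigr => k _; apply: eq_bigr => j _; rewrite /g; case: ltnP => // kj.
by have -> : val j = k by apply/eqP; rewrite eqn_leq kj -ltnS ltn_ord.
Qed.

(** Dropping the indicator leaves a product of probability densities. In [prior_prob_ge] this
    disposes of the normalising constant. *)
Lemma prior_u_le1 (A : set 'M[R]_p) :
  (prior_u (1/2) (1/2) (T ^+ 2) lam A <= 1)%E.
Proof.
apply: (@le_trans _ _ (iint (tri_dim p)
   (prior_u_dens p (1/2) (1/2) (T ^+ 2) lam))).
  apply: le_iint => s _; rewrite gee_pMl//.
  - rewrite prior_u_densE prode_ge0// => k _; exact: prode_ge0.
  - by rewrite lee_fin indicE; case: (_ \in _).
rewrite (eq_iint (G := fun s => (\prod_(k < p) \prod_(j < k.+1)
  g j k (nth 0%R s (tri_idx j k)))%E)); last by move=> s _; exact: prior_u_densE.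
rewrite iint_tri//; rewrite big1// => k _; rewrite big1// => j _.
rewrite /g; case: ifP => _; first exact: integral_offdiag_dens.
by rewrite integral_exponential_pdf// divr_gt0.
Qed.

Lemma prior_u_mono (A B : set 'M[R]_p) : A `<=` B ->
  (prior_u (1/2) (1/2) (T ^+ 2) lam A <= prior_u (1/2) (1/2) (T ^+ 2) lam B)%E.
Proof.
move=> AB; apply: le_iint => s _; apply: lee_wpmul2r.
  by rewrite prior_u_densE prode_ge0// => k _; exact: prode_ge0.
rewrite lee_fin !indicE ler_nat; case: (boolP (_ \in A)) => // /set_mem /AB.
by move=> /mem_set ->.
Qed.

Variables (S0 : 'M[R]_p) (d : R).
Hypothesis sS0 : S0^T = S0.

(** The factors in [iint_tri] are indexed by arbitrary pairs of naturals, hence this extension of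
    the entries of [S0] by [0]. *)
Let center (j k : nat) : R :=
  if (insub j : option 'I_p) is Some a then
    if (insub k : option 'I_p) is Some b then S0 a b else 0 else 0.

Let centerE (i j : 'I_p) : center i j = S0 i j.
Proof. by rewrite /center !valK. Qed.

Let I j k := (`[center j k - d, center j k + d]%classic : set R).

(** The indicator of [A] is replaced by that of the box, which is a product over coordinates, so
    that the iterated integral factorises. *)
Lemma prior_u_ge (A : set 'M[R]_p) :
  (forall S, S^T = S -> (forall i j, `|S i j - S0 i j| <= d) -> A S) ->
  (\prod_(k < p) \prod_(j < k.+1) \int[mu]_(x in I j k) g j k x <=
   prior_u (1/2) (1/2) (T ^+ 2) lam A)%E.
Proof.
move=> boxA; pose h j k := g j k \_ (I j k).
have mI j k : measurable (I j k) by exact: measurable_itv.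
have mh j k : measurable_fun [set: R] (h j k).
  by apply/(measurable_restrictT _ (mI j k)); exact: measurable_funTS.
have h0 j k x : (0 <= h j k x)%E by rewrite /h patchE; case: ifP.
under eq_bigr => k _ do under eq_bigr => j _ do rewrite integral_mkcond.
rewrite -(iint_tri _ mh h0); apply: le_iint => s _; rewrite prior_u_densE.
have [box|/existsNP[k /existsNP[j nbox]]] :=
    pselect (forall (k : 'I_p) (j : 'I_k.+1), I j k (nth 0 s (tri_idx j k))).
  have AS : A (symmx_of_seq p s).
    apply: boxA => [|i j]; first by apply/matrixP => i j; rewrite !mxE minnC maxnC.
    have key (a b : 'I_p) : (a <= b)%N -> `|nth 0 s (tri_idx a b) - S0 a b| <= d.
      move=> ab; have := box b (Ordinal (ab : (a < b.+1)%N)).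
      by rewrite /I/= centerE in_itv/= ler_distl.
    rewrite mxE; case: (leqP i j) => [ij|/ltnW ij]; first exact: key.
    by rewrite -sS0 mxE; exact: key.
  rewrite indicE mem_set// mul1e; apply: le_prode => k _; first exact: prode_ge0.
  apply: le_prode => j _ //; rewrite /h patchE; case: ifP => // _.
apply: (@le_trans _ _ 0%E).
  rewrite (bigD1 k)//= (bigD1 j)//= {1}/h patchE memNset//.
  by rewrite !mul0e.
apply: mule_ge0; first by rewrite lee_fin indicE; case: (_ \in _).
by apply: prode_ge0 => ? _; exact: prode_ge0.
Qed.

(** Every pair is charged [z], including those charged [q], which makes the count at most [p ^ 2].
    The factor [q] occurs once per diagonal entry and once per nonzero entry of one triangle;
    [offdiag_card] counts both triangles, so [s0] is an ample bound for the latter. *)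
Lemma prod_entries_ge (q z : R) (s0 : nat) (F : nat -> nat -> R) :
  0 < q <= 1 -> 0 < z <= 1 -> (offdiag_card S0 <= s0)%N ->
  (forall j k : 'I_p, (j <= k)%N ->
    q ^+ ((j == k) || (S0 j k != 0)) * z <= F j k) ->
  q ^+ (p + s0) * z ^+ (p ^ 2) <= \prod_(k < p) \prod_(j < k.+1) F j k.
Proof.
move=> /andP[q0 q1] /andP[z0 z1] cardS HF.
pose nz j k : bool := (j == k) || (center j k != 0).
have H (k : 'I_p) (j : 'I_k.+1) : q ^+ nz j k * z <= F j k.
  have jp : (j < p)%N by apply: leq_trans (ltn_ord j) (ltn_ord k).
  have jk : (Ordinal jp <= k)%N by rewrite -ltnS; exact: ltn_ord j.
  by have := HF _ _ jk; rewrite -centerE.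
apply: (@le_trans _ _ (\prod_(k < p) \prod_(j < k.+1) (q ^+ nz j k * z))); last first.
  apply: ler_prod => k _; apply/andP; split.
    by apply: prodr_ge0 => j _; rewrite mulr_ge0 ?exprn_ge0 ?ltW.
  by apply: ler_prod => j _; rewrite H mulr_ge0 ?exprn_ge0 ?ltW.
under eq_bigr => k _ do rewrite big_split/= prodrXr prodr_const card_ord.
rewrite big_split/= !prodrXr.
have q0' := ltW q0; have z0' := ltW z0.
apply: ler_pM; rewrite ?exprn_ge0//; last first.
  apply: ler_wiXn2l => //.
  apply: (@leq_trans (\sum_(k < p) p)%N); first by apply: leq_sum.
  by rewrite sum_nat_const card_ord mulnn.
apply: ler_wiXn2l => //.
have nzE (k : 'I_p) : (\sum_(j < k.+1) nz j k =
    \sum_(j < p | (j < k)%N) (S0 k j != 0%R) + 1)%N.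
  rewrite big_ord_recr/= {2}/nz eqxx/=; congr (_ + _)%N.
  rewrite (big_ord_widen p (fun j => nz j k : nat)) ?(ltnW (ltn_ord k))//.
  apply: eq_bigr => j jk; rewrite /nz centerE ltn_eqF//=.
  by rewrite -[in LHS]sS0 mxE.
under eq_bigr => k _ do rewrite nzE.
rewrite big_split/= sum1_card card_ord addnC leq_add2l.
apply: leq_trans cardS; rewrite pair_big_dep/= /offdiag_card -sum1_card.
rewrite big_mkcond [leqRHS]big_mkcond; apply: leq_sum => -[k j] _ /=.
case: ltnP => // jk; case: (boolP (S0 k j != 0)) => // Skj.
by rewrite ifT//; apply/mem_set; rewrite /= Skj andbT -val_eqE/= gtn_eqF.
Qed.

Lemma prior_prob_ge (q z tau : R) (s0 : nat) (A : set 'M[R]_p) :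
  0 < q <= 1 -> 0 < z <= 1 -> (offdiag_card S0 <= s0)%N ->
  (forall S, S^T = S -> (forall i j, `|S i j - S0 i j| <= d) ->
    A S /\ @U_tau R p tau S) ->
  (z%:E <= \int[mu]_(x in `[(- d)%R, d])
     offdiag_dens (1/2) (1/2) (T ^+ 2) x)%E ->
  (forall i j, i != j -> S0 i j != 0 ->
    (q%:E <= \int[mu]_(x in `[(S0 i j - d)%R, (S0 i j + d)%R])
       offdiag_dens (1/2) (1/2) (T ^+ 2) x)%E) ->
  (forall i, (q%:E <= \int[mu]_(x in `[(S0 i i - d)%R, (S0 i i + d)%R])
       diag_dens lam x)%E) ->
  q ^+ (p + s0) * z ^+ (p ^ 2) <= prior_prob (T ^+ 2) lam tau A.
Proof.
move=> q01 z01 cardS boxA hz hq hd.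
have /andP[q0 q1] := q01; have /andP[z0 z1] := z01.
set N := prior_u (1/2) (1/2) (T ^+ 2) lam (A `&` @U_tau R p tau).
set M := prior_u (1/2) (1/2) (T ^+ 2) lam (@U_tau R p tau).
have NM : (N <= M)%E by apply: prior_u_mono; exact: subIsetr.
have M1 : (M <= 1)%E by exact: prior_u_le1.
pose b (j k : nat) : R := if (j == k) || (center j k != 0) then q * z else z.
have b0 j k : 0 < b j k by rewrite /b; case: ifP => _ //; rewrite mulr_gt0.
have NE : ((q ^+ (p + s0) * z ^+ (p ^ 2))%:E <= N)%E.
  apply: le_trans (prior_u_ge boxA).
  apply: (@le_trans _ _ (\prod_(k < p) \prod_(j < k.+1) (b j k)%:E)%E).
    under eq_bigr => k _ do rewrite prodEFin.
    rewrite prodEFin lee_fin; apply: prod_entries_ge => // j k jk.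
    by rewrite /b centerE -val_eqE; case: ifP; rewrite ?expr0 ?expr1 ?mul1r.
  apply: le_prode => k _; first by apply: prode_ge0 => j _; rewrite lee_fin ltW.
  apply: le_prode => j _; first by rewrite lee_fin ltW.
  have jp : (j < p)%N by apply: leq_trans (ltn_ord j) (ltn_ord k).
  have cE : center j k = S0 (Ordinal jp) k by exact: (centerE (Ordinal jp) k).
  rewrite /b /I /g; have [jk|kj] := ltnP j k.
    rewrite (ltn_eqF jk)/= cE; case: ifPn => [Sjk|].
      apply: (@le_trans _ _ q%:E); first by rewrite lee_fin ler_piMr// ltW.
      by apply: hq => //; rewrite -val_eqE/= ltn_eqF.
    by rewrite negbK => /eqP ->; rewrite !add0r.
  have jk : j = k :> nat by apply/eqP; rewrite eqn_leq kj -ltnS ltn_ord.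
  rewrite jk eqxx/= centerE.
  by apply: (@le_trans _ _ q%:E); first by rewrite lee_fin ler_piMr// ltW.
(* Positivity of the box mass rules out a zero denominator, and [M <= 1] makes both [fine] values
   faithful and the division harmless. *)
have w0 : 0 < q ^+ (p + s0) * z ^+ (p ^ 2) by rewrite mulr_gt0// exprn_gt0.
rewrite /prior_prob -/N -/M.
move: NE NM M1; case: N => [n| |] //=; case: M => [m| |] //=.
rewrite !lee_fin => h1 h2 h3.
by rewrite ler_pdivlMr; nra.
Qed.

End Bounds.
End PriorMass.

(** * Kullback-Leibler neighbourhoods contain boxes *)


Section Neighbourhood.
Context {R : realType}.

Lemma bernoulli_ineq (x : R) p : 0 <= x <= 1 -> 1 - p%:R * x <= (1 - x) ^+ p.
Proof.
move=> /andP[x0 x1]; elim: p => [|p IH]; first by rewrite mul0r subr0 expr0.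
rewrite exprS -natr1; have h : 0 <= 1 - x by lra.
apply: le_trans (ler_wpM2l h IH); have := ler0n R p.
by move: (p%:R : R) => y y0; nra.
Qed.

(** The root is given away by [y <= Num.sqrt y] for [y <= 1]; then Bernoulli and
    [1 / (1 - v) <= 1 + 2 * v] for [0 <= v <= 1 / 2] conclude. *)
Lemma inv_sqrt_exp_le (x : R) p : 0 <= x -> x < 1 -> p%:R * x <= 2^-1 ->
  (Num.sqrt ((1 - x) ^+ p))^-1 - 1 <= 2 * (p%:R * x).
Proof.
move=> x0 x1 px; set y := (1 - x) ^+ p.
have y1 : y <= 1 by apply: exprn_ile1; lra.
have hy : 1 - p%:R * x <= y by apply: bernoulli_ineq; rewrite x0 ltW.
have y0 : 0 < y by lra.
have s0 : 0 < Num.sqrt y by rewrite sqrtr_gt0.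
have s2 : Num.sqrt y ^+ 2 = y by rewrite sqr_sqrtr// ltW.
have ys : y <= Num.sqrt y.
  have : Num.sqrt y <= 1 by rewrite -[leRHS]sqrtr1 ler_sqrt.
  by move: s2 s0; move: (Num.sqrt y) => s; nra.
have : (Num.sqrt y)^-1 <= y^-1 by rewrite lef_pV2.
suff : y^-1 <= 1 + 2 * (p%:R * x) by lra.
rewrite -[leLHS]mul1r ler_pdivrMr//.
have : 0 <= p%:R * x by rewrite mulr_ge0.
move: hy px; move: (p%:R * x) => v hy px v0; nra.
Qed.

(** [kappa] bounds the operator norm of [S - S0]. Its comparisons with the gaps between [tau0] and
    [tau] keep the spectrum in the truncation range, while [kappa <= (2 * tau0)^-1] bounds the
    spectrum of [S] below by [(2 * tau0)^-1], so that the divergence bound involves [tau0] and not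
    [tau]. The [8] is [4] from [KLvar] times [2] from [inv_sqrt_exp_le]. *)
Lemma box_subset p (S0 S : 'M[R]_p) (s0 : nat) (tau0 tau d eps : R)
  (kappa := p%:R * d) :
  1 < tau0 -> tau0 < tau -> U_s_tau s0 tau0 S0 -> S^T = S ->
  (forall i j, `|S i j - S0 i j| <= d) ->
  0 <= kappa -> kappa <= tau0^-1 - tau^-1 -> kappa <= tau - tau0 -> kappa <= (2 * tau0)^-1 ->
  p%:R * (2 * tau0 * kappa) ^+ 2 <= 2^-1 ->
  (2 * tau0 * kappa) ^+ 2 < 1 ->
  8 * (p%:R * (2 * tau0 * kappa) ^+ 2) < eps ^+ 2 ->
  B_eps S0 eps S /\ @U_tau R p tau S.
Proof.
move=> t01 t0t [pS0 [_ spec]] sS box k0 k1 k2 k3 small rho1 heps.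
have [sS0 pS0'] := pS0.
have t00 : 0 < tau0 by lra.
have lo0 x : tau0^-1 * sqnorm x <= qform S0 x.
  by apply: rayleigh_ge => // a /spec /andP[].
have hi0 x : qform S0 x <= tau0 * sqnorm x.
  by apply: rayleigh_le => // a /spec /andP[].
have dlt x : `|qform (S - S0) x| <= kappa * sqnorm x.
  by apply: qform_le_entries => i j; rewrite !mxE.
have lo x : (2 * tau0)^-1 * sqnorm x <= qform S x.
  have := dlt x; rewrite qformB ler_norml => /andP[h _].
  have := lo0 x; have := sqnorm_ge0 x; move: (sqnorm x) (qform S x) (qform S0 x) h => y a b.
  have : (2 * tau0)^-1 = tau0^-1 / 2 by field; rewrite gt_eqF.
  move: k3; move: (2 * tau0)^-1 (tau0^-1) => u v; nra.
have pS : posdef S.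
  split => // x x0; apply: lt_le_trans (lo x); rewrite mulr_gt0 ?sqnorm_gt0//.
  by rewrite invr_gt0 mulr_gt0.
split; last first.
  split => //; apply: spec_in_of_qform => // x.
  have := dlt x; rewrite qformB ler_norml => /andP[h1 h2].
  have := lo0 x; have := hi0 x; have := sqnorm_ge0 x.
  move: (sqnorm x) (qform S x) (qform S0 x) h1 h2 => y a b.
  by move: (tau0^-1) (tau^-1) k1 => u v k1 *; apply/andP; split; nra.
have lop : 0 < (2 * tau0)^-1 by rewrite invr_gt0 mulr_gt0.
have rhoE : (p%:R * d / (2 * tau0)^-1) ^+ 2 = (2 * tau0 * kappa) ^+ 2.
  by rewrite invrK mulrC.
have [] := KLdiv_KLvar_le pS0 pS lop lo box; rewrite rhoE// => K V.
have := inv_sqrt_exp_le (sqr_ge0 _) rho1 small => h.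
have h0 : 0 <= p%:R * (2 * tau0 * kappa) ^+ 2 by rewrite mulr_ge0 ?sqr_ge0.
split => //; split.
  by apply: (le_lt_trans K); rewrite lte_fin; lra.
by apply: (le_lt_trans V); rewrite lte_fin; lra.
Qed.

(** The exponential density is smallest at the right end of the interval, where [s + d <= 2 * h]
    compensates the rate [lam / 2]; [d <= s] keeps the interval on the half-line carrying the
    density. *)
Lemma diag_mass_ge (lam s d h : R) : 0 < lam -> 0 < d -> d <= s -> s + d <= 2 * h ->
  ((d * lam * expR (- (lam * h)))%:E <=
   \int[lebesgue_measure]_(x in `[(s - d)%R, (s + d)%R]) diag_dens lam x)%E.
Proof.
move=> lam0 d0 ds sh.
apply: (@le_trans _ _ (\int[lebesgue_measure]_(x in `[(s - d)%R, (s + d)%R])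
   (cst (lam / 2 * expR (- (lam * h)))%:E x))%E).
  rewrite integral_cst//= lebesgue_measure_itv/= lte_fin.
  have sd : s - d < s + d by lra.
  rewrite sd -EFinB -EFinM lee_fin le_eqVlt; apply/orP; left; apply/eqP.
  by field.
apply: le_integral_pointwise => x /=; rewrite in_itv/= => /andP[h1 h2].
rewrite lee_fin exponential_pdfE; last by lra.
rewrite ler_pM2l ?divr_gt0// ler_expR mulNr lerN2.
by rewrite -mulrA ler_pM2l// ler_pdivrMl//; lra.
Qed.

Lemma offdiag_mass_ge (T s d X : R) : 0 < T -> T <= 1 -> 0 < d -> `|s| + d <= X ->
  ((normal_peak 2 * expR (- X ^+ 2 / 2) * (3 / 40) * T * (2 * d))%:E <=
   \int[lebesgue_measure]_(x in `[(s - d)%R, (s + d)%R])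
     offdiag_dens (1/2) (1/2) (T ^+ 2) x)%E.
Proof.
move=> T0 T1 d0 sX; set c := _ * T.
apply: (@le_trans _ _ (\int[lebesgue_measure]_(x in `[(s - d)%R, (s + d)%R])
   (cst c%:E x))%E).
  rewrite integral_cst//= lebesgue_measure_itv/= lte_fin.
  have sd : s - d < s + d by lra.
  rewrite sd -EFinB -EFinM lee_fin le_eqVlt; apply/orP; left; apply/eqP.
  by congr (_ * _); ring.
apply: le_integral_pointwise => x /=; rewrite in_itv/= => /andP[h1 h2].
apply: offdiag_dens_lower => //; apply: le_trans sX.
rewrite -[x](subrK s) addrC; apply: (le_trans (ler_normD _ _)).
by rewrite lerD2l ler_norml; apply/andP; split; lra.
Qed.

End Neighbourhood.

(** * The non-asymptotic bound *)


Section Bound.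
Context {R : realType}.

Lemma expR_le_one_sub (x : R) : 0 <= x <= 2^-1 -> expR (- (2 * x)) <= 1 - x.
Proof.
move=> /andP[x0 x1]; rewrite expRN; apply: (@le_trans _ _ (1 + 2 * x)^-1).
  by rewrite lef_pV2 ?posrE ?expR_gt0 ?expR_ge1Dx//; lra.
by rewrite -[leLHS]mul1r ler_pdivrMr; nra.
Qed.

Lemma ln_mul3 (a b c : R) : 0 < a -> 0 < b -> 0 < c ->
  a * b * c = expR (ln a + ln b + ln c).
Proof.
by move=> a0 b0 c0; rewrite -!lnM ?posrE ?mulr_gt0// lnK// posrE !mulr_gt0.
Qed.

(** The two growth conditions combine to [tau ^ 2 * tau0 ^ 2 <= s0 * L <= N * (tau - tau0) ^ 2 * tau
    ^ 2], that is [tau0 <= r * (tau - tau0)]: the radius fits into the gap between [tau0] and [tau],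
    and into that between their inverses. *)
Lemma radius_bounds (N tau0 tau s0 L r : R) :
  1 < tau0 -> tau0 < tau -> 0 < L -> 0 <= s0 -> 0 < N -> 0 < r -> r ^+ 2 = N ->
  tau ^+ 2 * tau0 ^+ 2 <= s0 * L ->
  Num.max (1 / tau0 ^+ 4) (s0 / (1 - tau0 / tau) ^+ 2) * L / tau ^+ 4 <= N ->
  (r * tau)^-1 <= tau0^-1 - tau^-1 /\ (r * tau)^-1 <= tau - tau0.
Proof.
move=> t01 t0t L0 s00 N0 r0 rN h1 h2.
have t0 : 0 < tau by lra.
have t00 : 0 < tau0 by lra.
have e0 : 0 < tau - tau0 by lra.
set e := tau - tau0 in e0 *.
have h3 : s0 * L <= N * (e ^+ 2 * tau ^+ 2).
  have : s0 / (1 - tau0 / tau) ^+ 2 * L / tau ^+ 4 <= N.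
    apply: le_trans h2; rewrite ler_pM2r ?invr_gt0 ?exprn_gt0// ler_pM2r//.
    by rewrite le_max lexx orbT.
  have -> : s0 / (1 - tau0 / tau) ^+ 2 * L / tau ^+ 4 = s0 * L / (e ^+ 2 * tau ^+ 2).
    by rewrite /e; field; rewrite !gt_eqF.
  by rewrite ler_pdivrMr// mulr_gt0 ?exprn_gt0.
have h4 : tau0 <= r * e.
  have : tau ^+ 2 * tau0 ^+ 2 <= tau ^+ 2 * (r * e) ^+ 2.
    by apply: (le_trans h1); apply: (le_trans h3); rewrite exprMn rN mulrA mulrC.
  have re0 : 0 <= r * e by rewrite ltW// mulr_gt0.
  by rewrite ler_pM2l ?exprn_gt0// ler_pXn2r// nnegrE ltW.
split.
  have -> : tau0^-1 - tau^-1 = e / (tau0 * tau) by rewrite /e; field; rewrite !gt_eqF.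
  rewrite -[leLHS]mul1r ler_pdivrMr ?mulr_gt0// mulrAC ler_pdivlMr ?mulr_gt0//.
  by rewrite mul1r mulrCA mulrA ler_pM2r.
rewrite -[leLHS]mul1r ler_pdivrMr ?mulr_gt0//.
have : 1 <= r * e by lra.
rewrite mulrA [e * r]mulrC => h5; apply: (le_trans h5).
by rewrite ler_peMr; lra.
Qed.

(* The box has half-width [d = 1 / (p * sqrt n * tau)]. A diagonal entry or a
   nonzero off-diagonal entry of [S0] costs a factor [p ^ - (4 + 1 / beta)],
   and the zero entries together cost at most a factor [p ^ - p]. *)
Lemma prior_prob_lower (p s0 n : nat) (S0 : 'M[R]_p) (tau0 tau tau1 lam beta C c3 c4 : R)
  (L := ln p%:R) (eps := Num.sqrt ((p + s0)%:R * L / n%:R))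
  (k := normal_peak 2 * expR (- (tau0 + 1) ^+ 2 / 2) * (3 / 40)) :
  1 < tau0 -> 0 < beta -> 0 < c3 -> 0 < c4 ->
  U_s_tau s0 tau0 S0 -> tau0 < tau -> tau ^+ 4 <= p%:R ->
  tau ^+ 2 * tau0 ^+ 2 <= s0%:R * L ->
  Num.max (1 / tau0 ^+ 4) (s0%:R / (1 - tau0 / tau) ^+ 2) * L / tau ^+ 4 <= n%:R ->
  p%:R^-1 < lam < L / tau0 ->
  c3 / (n%:R * p%:R ^+ 4 * tau ^+ 2) <= tau1 ^+ 2 <=
    c4 / (n%:R * p%:R ^+ 4 * tau ^+ 2) ->
  ln n%:R <= C + L / beta ->
  4 * tau0 ^+ 2 <= n%:R -> c4 <= n%:R -> 8 * tau0 ^+ 2 * p%:R <= n%:R ->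
  32 * tau0 ^+ 2 < L -> 64 * Num.sqrt c4 <= p%:R -> 64 * Num.sqrt c4 <= L ->
  2 * C - ln c3 - 2 * ln (2 * k) <= L -> C <= L ->
  expR (- ((5 + 1 / beta) * n%:R * eps ^+ 2)) <=
    prior_prob (tau1 ^+ 2) lam tau (B_eps S0 eps).
Proof.
move=> t01 b0 c30 c40 US t0t tP tsL hmax lamP tau1b lnN Nt Nc4 NP Lt Pc4 Lc4 LK LC.
pose P : R := p%:R; pose N : R := n%:R.
rewrite -/P -/N in tP lamP tau1b hmax lnN Nt Nc4 NP Pc4.
have t02 : 1 < tau0 ^+ 2 by rewrite exprn_egt1// ltW.
have L0 : 0 < L by lra.
have P1 : 1 < P.
  by rewrite ltNge; apply/negP => /ln_le0; rewrite -/L leNgt L0.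
have P0 : 0 < P by lra.
have N1 : 1 < N by lra.
have N0 : 0 < N by lra.
have t1 : 1 < tau by lra.
have t0 : 0 < tau by lra.
have t00 : 0 < tau0 by lra.
have tt : 1 < tau ^+ 2 by rewrite exprn_egt1// ltW.
have s00 : 0 <= s0%:R :> R by exact: ler0n.
pose r := Num.sqrt N; have r0 : 0 < r by rewrite sqrtr_gt0.
have rN : r ^+ 2 = N by rewrite sqr_sqrtr// ltW.
have r2t : 2 * tau0 <= r.
  rewrite -(@ler_pXn2r _ 2) ?nnegrE ?mulr_ge0 ?(ltW r0) ?(ltW t00)//.
  by rewrite rN exprMn; move: Nt; clear; lra.
pose kap := (r * tau)^-1; have kap0 : 0 < kap by rewrite invr_gt0 mulr_gt0.
have [kap1 kap2] := radius_bounds t01 t0t L0 s00 N0 r0 rN tsL hmax.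
rewrite -/kap in kap1 kap2.
have kap3 : kap <= (2 * tau0)^-1.
  rewrite lef_pV2 ?posrE ?mulr_gt0//; apply: (le_trans r2t).
  by rewrite ler_peMr// ltW.
have kapsq : kap ^+ 2 = (N * tau ^+ 2)^-1 by rewrite exprVn exprMn rN.
pose d := kap / P; have d0 : 0 < d by rewrite divr_gt0.
have Pd : P * d = kap by rewrite /d mulrC divfK// gt_eqF.
have dk : d <= kap by rewrite ler_pdivrMr// ler_peMr// ltW.
have NtN : N <= N * tau ^+ 2 by rewrite ler_peMr// ltW.
have small : P * (2 * tau0 * kap) ^+ 2 <= 2^-1.
  rewrite exprMn kapsq mulrA ler_pdivrMr ?mulr_gt0//.
  by rewrite exprMn; move: NP NtN; clear; lra.
have rho0 : 0 <= (2 * tau0 * kap) ^+ 2 by exact: sqr_ge0.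
have rho1 : (2 * tau0 * kap) ^+ 2 < 1.
  by move: (_ ^+ 2) rho0 small P1; clear => x x0 hx P1; nra.
have eps2 : eps ^+ 2 = (P + s0%:R) * L / N.
  by rewrite /eps natrD sqr_sqrtr// divr_ge0 ?mulr_ge0 ?addr_ge0 ?(ltW L0) ?(ltW N0) ?(ltW P0).
(* Only the part [P * L / N] of [eps ^+ 2] is used; [L] exceeds the constant [32 * tau0 ^+ 2]. *)
have heps : 8 * (P * (2 * tau0 * kap) ^+ 2) < eps ^+ 2.
  rewrite eps2 exprMn kapsq; apply: (@lt_le_trans _ _ (P * L / N)); last first.
    rewrite ler_pM2r ?invr_gt0// ler_pM2r// lerDl//.
  apply: (@le_lt_trans _ _ (P * (32 * tau0 ^+ 2) / N)); last first.
    by rewrite ltr_pM2r ?invr_gt0// ltr_pM2l.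
  rewrite exprMn ler_pdivlMr//.
  have -> : 8 * (P * (2 ^+ 2 * tau0 ^+ 2 / (N * tau ^+ 2))) * N =
      P * (32 * tau0 ^+ 2) * (tau ^+ 2)^-1 by field; rewrite !gt_eqF.
  have w0 : 0 <= P * (32 * tau0 ^+ 2) by rewrite ltW// mulr_gt0// mulr_gt0// exprn_gt0.
  rewrite ler_piMr// invf_le1; first exact: ltW.
  exact: lt_trans tt.
have box S : S^T = S -> (forall i j, `|S i j - S0 i j| <= d) ->
    B_eps S0 eps S /\ @U_tau R p tau S.
  move=> sS bS; apply: (box_subset t01 t0t US sS bS); rewrite -/P Pd//.
  exact: ltW.
(* Only [tau1 ^+ 2] is constrained, so [tau1] may be negative. *)
pose T : R := `|tau1|; have T2 : T ^+ 2 = tau1 ^+ 2 by rewrite real_normK ?num_real.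
have D0 : 0 < N * P ^+ 4 * tau ^+ 2 by rewrite !mulr_gt0 ?exprn_gt0.
have /andP[Tlo Thi] := tau1b.
have T20 : 0 < T ^+ 2 by rewrite T2; apply: lt_le_trans Tlo; rewrite divr_gt0.
have T0 : 0 < T by rewrite normr_gt0; move: T20; rewrite T2; case: eqVneq => // ->; rewrite expr0n ltxx.
have T1 : T <= 1.
  rewrite -(@ler_pXn2r _ 2) ?nnegrE ?(ltW T0)// T2 expr1n; apply: (le_trans Thi).
  rewrite ler_pdivrMr// mul1r; apply: (le_trans Nc4); rewrite -mulrA ler_peMr ?(ltW N0)//.
  by rewrite mulr_ege1 ?exprn_ege1 ?(ltW P1) ?(ltW t1).
pose c := 32 * Num.sqrt c4; have c0 : 0 <= c by rewrite mulr_ge0.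
pose z := 1 - c / P.
have cP : 0 <= c / P <= 2^-1.
  rewrite divr_ge0 ?(ltW P0)//= ler_pdivrMr// /c.
  by move: Pc4; clear; lra.
have z01 : 0 < z <= 1 by move: cP; rewrite /z; clear; move=> /andP[? ?]; lra.
(* The rate of [tau1] matches the box: [T / d = T * r * tau * P], which the upper bound on
   [tau1 ^+ 2] makes at most [Num.sqrt c4 / P]. *)
have Td : 32 * (T / d) <= c / P.
  rewrite -mulrA ler_pM2l// /d invfM invrK /kap invrK ler_pdivlMr//.
  rewrite -(@ler_pXn2r _ 2) ?nnegrE ?mulr_ge0 ?(ltW T0) ?(ltW P0) ?(ltW r0) ?(ltW t0)//.
  rewrite sqr_sqrtr ?(ltW c40)//.
  have -> : (T * (r * tau * P) * P) ^+ 2 = T ^+ 2 * (r ^+ 2 * P ^+ 4 * tau ^+ 2) by ring.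
  by rewrite rN T2 -ler_pdivlMr.
(* For a nonzero off-diagonal entry, [ln T + ln d] is at least [- ln N - 3 * L - 2 * ln tau] up to a
   constant. By [ln N <= C + L / beta] and [4 * ln tau <= L] this costs [(7 / 2 + 1 / beta) * L],
   and the spare [L / 2] absorbs the constants. For a diagonal entry, [lam > 1 / P] and
   [lam * tau0 < L] replace the cost of [T] by at most [2 * L]. *)
pose q := expR (- (4 + 1 / beta) * L).
have ib0 : 0 < 1 / beta by rewrite divr_gt0.
have q01 : 0 < q <= 1.
  rewrite expR_gt0 expR_le1 nmulr_rle0 ?(ltW L0)//.
  by move: ib0; clear; lra.
have lnr : ln r = ln N / 2 by rewrite -rN lnXn// mulr2n -mulr2n -[_ *+ 2]mulr_natr mulfK.
have lnt : 4 * ln tau <= L.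
  have : ln (tau ^+ 4) <= L by rewrite ler_ln ?posrE ?exprn_gt0.
  by rewrite lnXn// mulr_natl.
have lnt0 : 0 <= ln tau by rewrite ln_ge0// ltW.
have lnd : ln d = - (ln N / 2) - ln tau - L.
  by rewrite /d /kap ln_div ?posrE// lnV ?posrE ?mulr_gt0// lnM ?posrE// lnr opprD.
have k0 : 0 < k by rewrite mulr_gt0// mulr_gt0 ?expR_gt0// normal_peak_gt0.
have lnT : 2 * ln T >= ln c3 - ln N - 4 * L - 2 * ln tau.
  have -> : 2 * ln T = ln (T ^+ 2) by rewrite lnXn// mulr_natl.
  apply: (@le_trans _ _ (ln (c3 / (N * P ^+ 4 * tau ^+ 2)))); last first.
    by rewrite ler_ln ?posrE ?divr_gt0// T2.
  have -> : N * P ^+ 4 * tau ^+ 2 = N * (P * (P * (P * P))) * (tau * tau) by ring.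
  rewrite ln_div ?posrE ?mulr_gt0// !lnM ?posrE ?mulr_gt0// -[ln P]/L.
  by rewrite le_eqVlt; apply/orP; left; apply/eqP; ring.
have bL : L / beta = 1 / beta * L by rewrite mul1r mulrC.
have [sS0 pS0] := US.1.
have [cardS spec] := US.2.
have lo0 x : tau0^-1 * sqnorm x <= qform S0 x.
  by apply: rayleigh_ge => // a /spec /andP[].
have hi0 x : 0 <= qform S0 x <= tau0 * sqnorm x.
  apply/andP; split.
    by apply: le_trans (lo0 x); rewrite mulr_ge0 ?sqnorm_ge0 ?invr_ge0 ?(ltW t00).
  by apply: rayleigh_le => // a /spec /andP[].
have entry := entry_le_qform sS0 hi0.
have it0 : (2 * tau0)^-1 <= 2^-1 by rewrite lef_pV2 ?posrE ?mulr_gt0//; move: t01; clear; lra.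
have dhalf : d <= 2^-1 by move: dk kap3 it0; clear; lra.
rewrite -T2; apply: (@le_trans _ _ (q ^+ (p + s0) * z ^+ (p ^ 2))); last first.
  have /andP[lam1 lam2] := lamP.
  have lam0 : 0 < lam by apply: lt_trans lam1; rewrite invr_gt0.
  apply: (prior_prob_ge T0 lam0 sS0 q01 z01 cardS box).
  - apply: le_trans (integral_offdiag_dens_center T0 d0); rewrite lee_fin /z; move: Td; clear; lra.
  - move=> i j ij Sij.
    have sX : `|S0 i j| + d <= tau0 + 1 by have := entry i j; move: dhalf; clear; lra.
    apply: le_trans (offdiag_mass_ge T0 T1 d0 sX); rewrite lee_fin -/k.
    have -> : k * T * (2 * d) = 2 * k * T * d by ring.
    have k2 : 0 < 2 * k by apply: mulr_gt0.
    rewrite (ln_mul3 k2 T0 d0) ler_expR lnd.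
    move: LK lnT lnN lnt; rewrite bL; clear.
    move: (1 / beta) (ln (2 * k)) (ln T) (ln tau) (ln N) (ln c3) => x1 x2 x3 x4 x5 x6.
    lra.
  - move=> i.
    have dS : d <= S0 i i.
      have := lo0 (delta_mx i 0); rewrite qform_delta.
      have -> : sqnorm (delta_mx i 0 : 'cV[R]_p) = 1.
        by rewrite -qform1 qform_delta mxE eqxx.
      rewrite mulr1; have : (2 * tau0)^-1 <= tau0^-1.
        by rewrite lef_pV2 ?posrE ?mulr_gt0//; move: t00; clear; lra.
      by move: dk kap3; clear; lra.
    have Sd : S0 i i + d <= 2 * tau0.
      by have := entry i i; rewrite ler_norml => /andP[_]; move: dhalf t01; clear; lra.
    apply: le_trans (diag_mass_ge lam0 d0 dS Sd); rewrite lee_fin.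
    rewrite (ln_mul3 d0 lam0 (expR_gt0 _)) ler_expR expRK lnd.
    have : - L < ln lam by rewrite -lnV ?posrE// ltr_ln ?posrE ?invr_gt0.
    have : lam * tau0 < L by rewrite -ltr_pdivlMr.
    have : 0 <= 1 / beta * L by rewrite mulr_ge0 ?(ltW L0) ?(ltW ib0).
    move: lnN lnt L0 LC; rewrite bL; clear.
    move: (1 / beta) (ln lam) (ln tau) (ln N) (lam * tau0) => x1 x2 x3 x4 x5; lra.
(* Raised to the power [p ^ 2] this gives [exp (- (2 * c) * P)] with [2 * c <= L], which accounts
   for the fifth unit in [5 + 1 / beta]. *)
have zE : expR (- (2 * (c / P))) <= z by exact: expR_le_one_sub.
apply: (@le_trans _ _ (q ^+ (p + s0) * expR (- (2 * (c / P))) ^+ (p ^ 2))); last first.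
  rewrite ler_pM2l; last by rewrite exprn_gt0// expR_gt0.
  by apply: lerXn2r; rewrite ?nnegrE ?expR_ge0// ltW//; case/andP: z01.
rewrite /q -!expRM_natl -expRD ler_expR eps2 natrX natrD -/P.
have -> : P ^+ 2 * - (2 * (c / P)) = - (2 * c) * P by field; rewrite gt_eqF.
have -> : (5 + 1 / beta) * N * ((P + s0%:R) * L / N) = (5 + 1 / beta) * L * (P + s0%:R).
  by field; rewrite !gt_eqF.
have h1 : 2 * c * P <= L * P by rewrite ler_pM2r// /c; move: Lc4; clear; lra.
have h2 : 0 <= L * s0%:R by rewrite mulr_ge0 ?(ltW L0).
have -> : - ((5 + 1 / beta) * L * (P + s0%:R)) =
  (P + s0%:R) * (- (4 + 1 / beta) * L) - L * P - L * s0%:R by ring.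
by rewrite -!addrA lerD2l; move: h1 h2; clear; lra.
Qed.

End Bound.

(** * Large sample sizes *)


Lemma near_powR_ge (R : realType) (b K : R) : 0 < b ->
  \forall n \near \oo, K <= n%:R `^ b.
Proof.
move=> b0; near=> n; apply: (le_trans (ler_norm K)).
have -> : `|K| = (`|K| `^ b^-1) `^ b by rewrite -powRrM mulVf ?powRr1// gt_eqF.
apply: ge0_ler_powR; rewrite ?nnegrE ?powR_ge0// ?(ltW b0)//.
by near: n; exact: nbhs_infty_ger.
Unshelve. all: by end_near. Qed.

Unset Implicit Arguments.

Theorem theorem5 (R : realType) (beta tau0 : R) (p s0 : nat -> nat)
  (tau tau1 lam : nat -> R) (Sigma0 : forall n : nat, 'M[R]_(p n)) :
  1 < tau0 ->
  (forall n, (0 < s0 n)%N) ->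
  0 < beta < 1 ->
  (* p asymp n^beta *)
  (exists c1 c2 : R, 0 < c1 /\ 0 < c2 /\
     \forall n \near \oo,
       c1 * n%:R `^ beta <= (p n)%:R <= c2 * n%:R `^ beta) ->
  (* tau1^2 asymp 1/(n p^4 tau^2) *)
  (exists c3 c4 : R, 0 < c3 /\ 0 < c4 /\
     \forall n \near \oo,
       c3 / (n%:R * (p n)%:R ^+ 4 * tau n ^+ 2) <= tau1 n ^+ 2
       <= c4 / (n%:R * (p n)%:R ^+ 4 * tau n ^+ 2)) ->
  (\forall n \near \oo,
     @U_s_tau R (p n) (s0 n) tau0 (Sigma0 n) /\
     tau0 < tau n /\
     tau n ^+ 4 <= (p n)%:R /\
     tau n ^+ 2 * tau0 ^+ 2 <= (s0 n)%:R * ln (p n)%:R /\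
     Num.max (1 / tau0 ^+ 4) ((s0 n)%:R / (1 - tau0 / tau n) ^+ 2)
       * ln (p n)%:R / tau n ^+ 4 <= n%:R /\
     (p n)%:R^-1 < lam n < ln (p n)%:R / tau0) ->
  \forall n \near \oo,
    let eps := Num.sqrt (((p n + s0 n)%:R * ln (p n)%:R) / n%:R) in
    expR (- ((5 + 1 / beta) * n%:R * eps ^+ 2))
      <= prior_prob (tau1 n ^+ 2) (lam n) (tau n) (B_eps (Sigma0 n) eps).
Proof.
move=> t01 _ /andP[b0 b1] [c1 [c2 [c10 [c20 hp]]]] [c3 [c4 [c30 [c40 ht]]]] H.
have pK (K : R) : \forall n \near \oo, K <= (p n)%:R.
  near=> n; have /andP[+ _] : c1 * n%:R `^ beta <= (p n)%:R <= c2 * n%:R `^ beta.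
    by near: n.
  apply: le_trans; rewrite -ler_pdivrMl//.
  by near: n; exact: near_powR_ge.
have lK (K : R) : \forall n \near \oo, K <= ln (p n)%:R.
  near=> n; have h : expR K <= (p n)%:R by near: n; exact: pK.
  by rewrite -[K]expRK ler_ln ?posrE ?expR_gt0// (lt_le_trans (expR_gt0 K)).
have nK (K : R) : \forall n \near \oo, K <= n%:R by exact: nbhs_infty_ger.
near=> n => /=.
have [US [t0t [tP [tsL [hmax hlam]]]]] :
    U_s_tau (s0 n) tau0 (Sigma0 n) /\ tau0 < tau n /\ tau n ^+ 4 <= (p n)%:R /\
    tau n ^+ 2 * tau0 ^+ 2 <= (s0 n)%:R * ln (p n)%:R /\
    Num.max (1 / tau0 ^+ 4) ((s0 n)%:R / (1 - tau0 / tau n) ^+ 2)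
       * ln (p n)%:R / tau n ^+ 4 <= n%:R /\
    (p n)%:R^-1 < lam n < ln (p n)%:R / tau0 by near: n.
have /andP[p1 p2] : c1 * n%:R `^ beta <= (p n)%:R <= c2 * n%:R `^ beta by near: n.
have n0 : 0 < n%:R :> R.
  by apply: (@lt_le_trans _ _ 1) => //; near: n; exact: nK.
(* The constant [- ln c1 / beta] comes from taking logarithms in [c1 * n ^ beta <= p]. *)
apply: (@prior_prob_lower R (p n) (s0 n) n (Sigma0 n) tau0 (tau n) (tau1 n)
  (lam n) beta (- ln c1 / beta) c3 c4) => //.
- by near: n.
- rewrite -mulrDl ler_pdivlMr// addrC lerBrDr mulrC addrC -ln_powR -lnM ?posrE ?powR_gt0//.
  by rewrite ler_ln ?posrE ?mulr_gt0 ?powR_gt0// (lt_le_trans _ p1)// mulr_gt0 ?powR_gt0.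
- by near: n; exact: nK.
- by near: n; exact: nK.
(* Here [beta < 1] enters: [p] is at most [c2 * n ^ beta], and [n ^ (1 - beta)] outgrows any
   constant. *)
- apply: (@le_trans _ _ (8 * tau0 ^+ 2 * (c2 * n%:R `^ beta))).
    by rewrite ler_wpM2l// mulr_ge0// sqr_ge0.
  rewrite -[leRHS]powRr1 ?(ltW n0)//.
  have -> : n%:R `^ 1 = n%:R `^ (1 - beta) * n%:R `^ beta :> R.
    by rewrite -powRD ?subrK// (gt_eqF n0) implybT.
  rewrite mulrA ler_pM2r ?powR_gt0//.
  by near: n; apply: near_powR_ge; rewrite subr_gt0.
- apply: (@lt_le_trans _ _ (32 * tau0 ^+ 2 + 1)); first by rewrite ltrDl.
  by near: n; exact: lK.
- by near: n; exact: pK.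
- by near: n; exact: lK.
- by near: n; exact: lK.
- by near: n; exact: lK.
Unshelve. all: by end_near. Qed.
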